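(* Let $\mathbb F$ be a sufficiently large field. Given $n,d,w$, one can compute in time $(ndw)^{O(\log n)}$ an $n$-tuple of univariate polynomials $\mathbf f(t)\in\mathbb F[t]^n$ of degree $(ndw)^{O(\log n)}$ such that for every $n$-variate polynomial $A(\mathbf x)\in\mathbb F^{w\times w}[\mathbf x]$ (or $A\in\mathbb F^{1\times w}[\mathbf x]$, or $A\in\mathbb F[\mathbf x]$) of individual degree at most $d$ that can be computed by an ROABP of width $w$, the polynomial $A(\mathbf x+\mathbf f(t))$ is $\log(w^2+1)$-concentrated.
   Context: A matrix polynomial $A\in\mathbb F^{w\times w}[\mathbf x]$ is computed by an ROABP of width $w$ with variable order $(x_{\pi(1)},\dots,x_{\pi(n)})$ ($\pi$ a permutation of $[n]$) if $A=D_1\cdots D_n$ with $D_i\in\mathbb F[x_{\pi(i)}]^{w\times w}$; for $A\in\mathbb F^{1\times w}[\mathbf x]$ the same with $D_1\in\mathbb F[x_{\pi(1)}]^{1\times w}$; for $A\in\mathbb F[\mathbf x]$ additionally $D_n\in\mathbb F[x_{\pi(n)}]^{w\times1}$. Individual degree $d$ means each variable has degree at most $d$ in every monomial. For $\mathbf a\in\mathbb N^n$, $\mathrm{supp}(\mathbf a)=|\{i:a_i\ne0\}|$. $A(\mathbf x+\mathbf f(t))=A(x_1+f_1(t),\dots,x_n+f_n(t))$, with coefficients over $\mathbb F[t]$; it is $\ell$-concentrated if every coefficient $\mathrm{coeff}(\mathbf x^{\mathbf a})$ lies in $\mathrm{Span}_{\mathbb F(t)}\{\mathrm{coeff}(\mathbf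 x^{\mathbf b})\mid\mathrm{supp}(\mathbf b)<\ell\}$. $\log$ is base 2. *)

(* Defs.v *)
From HB Require Import structures.
From mathcomp Require Import all_boot all_order all_fingroup all_algebra.
From mathcomp Require Import fraction.
From mathcomp Require Export mpoly.

Set Implicit Arguments.
Unset Strict Implicit.
Unset Printing Implicit Defensive.

Import GRing.Theory.
Local Open Scope ring_scope.

(* Matrix polynomials, F^{r x c}[x_0, .., x_(n-1)], are matrices of polynomials. *)

Definition univariate_in (R : nzRingType) (n r c : nat) (i : 'I_n)
    (D : 'M[{mpoly R[n]}]_(r, c)) : Prop :=
  forall a b m, m \in msupp (D a b) -> forall j, j != i -> m j = 0%N.

Definition individual_degree_le (R : nzRingType) (n r c d : nat)
    (A : 'M[{mpoly R[n]}]_(r, c)) : Prop :=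
  forall a b m, m \in msupp (A a b) -> forall j, (m j <= d)%N.

(* A = D_1 *m .. *m D_k with D_l univariate in the l-th variable of s; all the  *)
(* inner dimensions are w, the outer ones are those of A. (A single layer is a  *)
(* matrix of the dimensions of A; the empty product is never needed.)           *)
Fixpoint layered_product (R : comNzRingType) (n w c : nat) (s : seq 'I_n)
    (r : nat) (A : 'M[{mpoly R[n]}]_(r, c)) : Prop :=
  match s with
  | [::] => False
  | [:: i] => univariate_in i A
  | i :: s' =>
      exists (D : 'M[{mpoly R[n]}]_(r, w)) (B : 'M[{mpoly R[n]}]_(w, c)),
        [/\ univariate_in i D, layered_product w s' B & A = D *m B]
  end.

(* With (r, c) = (w, w), (1, w), (1, 1) this covers F^{w x w}[x], F^{1 x w}[x]  *)
(* and F[x] respectively.                                                       *)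
Definition computed_by_roabp (R : comNzRingType) (n w r c : nat)
    (A : 'M[{mpoly R[n]}]_(r, c)) : Prop :=
  exists pi : 'S_n, layered_product w [seq pi i | i <- enum 'I_n] A.

Definition mnm_supp (n : nat) (a : 'X_{1..n}) : nat := #|[set i | a i != 0%N]|.

Definition mx_coeff (R : nzRingType) (n r c : nat)
    (A : 'M[{mpoly R[n]}]_(r, c)) (a : 'X_{1..n}) : 'M[R]_(r, c) :=
  map_mx (fun p => p@_a) A.

Definition shift (F : fieldType) (n r c : nat) (f : n.-tuple {poly F})
    (A : 'M[{mpoly F[n]}]_(r, c)) : 'M[{mpoly {poly F}[n]}]_(r, c) :=
  map_mx (fun p => comp_mpoly [tuple 'X_i + (tnth f i)%:MP | i < n]
                     (map_mpoly polyC p)) A.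

Definition ft_coeff (F : fieldType) (n r c : nat)
    (B : 'M[{mpoly {poly F}[n]}]_(r, c)) (a : 'X_{1..n}) :
    'M[{fraction {poly F}}]_(r, c) :=
  map_mx (@FracField.tofrac {poly F}) (mx_coeff B a).

Definition concentrated (F : fieldType) (n r c l : nat)
    (B : 'M[{mpoly {poly F}[n]}]_(r, c)) : Prop :=
  forall a : 'X_{1..n},
    exists (s : seq 'X_{1..n}) (u : 'X_{1..n} -> {fraction {poly F}}),
      all (fun b => mnm_supp b < l)%N s
      /\ ft_coeff B a = \sum_(b <- s) u b *: ft_coeff B b.

(* For an integer k, k < log2 x iff k < up_log 2 x = ceil (log2 x), so that     *)
(* replacing log2 (w ^ 2 + 1) by its ceiling leaves concentration unchanged.    *)
Definition roabp_threshold (w : nat) : nat := up_log 2 (w ^ 2 + 1).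

(* The generic bound (n d w)^{O(log n)}, with hidden constant c. For n >= 2 and *)
(* d, w > 0 both maxn's are vacuous and this is (n d w)^(c * floor(log2 n));    *)
(* they only make the bound meaningful when n = 1, where log n = 0.             *)
Definition qpoly_bound (c n d w : nat) : nat :=
  (maxn 2 (n * d * w) ^ (c * trunc_log 2 (maxn 2 n)))%N.

(* The model of computation is a unit-cost random access machine over a field,  *)
(* with a memory of natural numbers N and a memory of field elements F. Natural *)
(* numbers have addition and subtraction but no multiplication, so that a step  *)
(* costs at most polynomially more on a Turing machine. Programs contain no     *)
(* field element: the same program runs over all fields. Field cells are always *)
(* addressed indirectly, through the content of a natural-number cell.          *)

Inductive instr : Type :=
| NConst of nat & nat
| NMove of nat & nat
| NAdd of nat & nat & nat
| NSub of nat & nat & nat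
| NLoad of nat & nat
| NStore of nat & nat
| FZero of nat
| FOne of nat
| FMove of nat & nat
| FAdd of nat & nat & nat
| FSub of nat & nat & nat
| FMul of nat & nat & nat
| FInv of nat & nat.

Inductive test : Type :=
| NLt of nat & nat
| FIsZero of nat.

Inductive program : Type :=
| Skip
| Instr of instr
| Seq of program & program
| If of test & program & program
| While of test & program.

Record state (K : Type) := State { nmem : nat -> nat; fmem : nat -> K }.

Definition upd (T : Type) (m : nat -> T) (i : nat) (v : T) : nat -> T :=
  fun j => if j == i then v else m j.

Section Semantics.
Variable K : fieldType.
Implicit Types st : state K.

Definition nset st i v := State (upd (nmem st) i v) (fmem st).
Definition fset st i v := State (nmem st) (upd (fmem st) (nmem st i) v).
Definition fget st j : K := fmem st (nmem st j).

Definition exec_instr (x : instr) st : state K :=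
  match x with
  | NConst i k => nset st i k
  | NMove i j => nset st i (nmem st j)
  | NAdd i j k => nset st i (nmem st j + nmem st k)%N
  | NSub i j k => nset st i (nmem st j - nmem st k)%N
  | NLoad i j => nset st i (nmem st (nmem st j))
  | NStore i j => nset st (nmem st i) (nmem st j)
  | FZero i => fset st i 0
  | FOne i => fset st i 1
  | FMove i j => fset st i (fget st j)
  | FAdd i j k => fset st i (fget st j + fget st k)
  | FSub i j k => fset st i (fget st j - fget st k)
  | FMul i j k => fset st i (fget st j * fget st k)
  | FInv i j => fset st i (fget st j)^-1
  end.

Definition eval_test (b : test) st : bool :=
  match b with
  | NLt i j => (nmem st i < nmem st j)%N
  | FIsZero i => fget st i == 0
  end.

(* exec p st st' t: started in st, p halts in st' after t steps *)
Inductive exec : program -> state K -> state K -> nat -> Prop :=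
| exec_skip st : exec Skip st st 0
| exec_instr1 x st : exec (Instr x) st (exec_instr x st) 1
| exec_seq p q st1 st2 st3 t1 t2 :
    exec p st1 st2 t1 -> exec q st2 st3 t2 ->
    exec (Seq p q) st1 st3 (t1 + t2)
| exec_if b p q st st' t :
    exec (if eval_test b st then p else q) st st' t ->
    exec (If b p q) st st' t.+1
| exec_while_done b p st :
    ~~ eval_test b st -> exec (While b p) st st 1
| exec_while_step b p st1 st2 st3 t1 t2 :
    eval_test b st1 -> exec p st1 st2 t1 -> exec (While b p) st2 st3 t2 ->
    exec (While b p) st1 st3 (t1 + t2).+1.

(* N = n, d, w, 0, 0, ..; F = alpha_0, alpha_1, .., 0, 0, ..                    *)
(* The list alpha is the program's access to distinct elements of the field.    *)
Definition initial_state (n d w : nat) (alpha : seq K) : state K :=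
  State (nth 0%N [:: n; d; w]) (nth 0 alpha).

(* Dense output: with L = N[0], the coefficient of t^k in f_i is F[i * L + k].  *)
Definition output_polys (n : nat) st : n.-tuple {poly K} :=
  [tuple \poly_(k < nmem st 0) fmem st (i * nmem st 0 + k) | i < n].

(* P computes f from (n, d, w, alpha) in time at most T. Writing out the n * L  *)
(* coefficients of the output is counted in the running time.                   *)
Definition computes_within (P : program) (n d w : nat) (alpha : seq K)
    (f : n.-tuple {poly K}) (T : nat) : Prop :=
  exists (st : state K) (t : nat),
    [/\ exec P (initial_state n d w alpha) st t,
        f = output_polys n st
      & (t + n * nmem st 0 <= T)%N].

End Semantics.

(* Main.v *)
(* Take f_i = prod_j (t - alpha_j) ^ W_j(i), where W_j runs over quasi-           *)
(* polynomially many weight functions. Suppose some W = W_j isolates, among the   *)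
(* coefficients of A, a set S of at most w ^ 2 monomials: every other coefficient *)
(* is a combination of the coefficients of S of smaller weight. If the low-       *)
(* support coefficients of A(x + f) did not span, a linear functional over F(t)   *)
(* would kill them but not A. It turns A into g with g(x + f) free of low-support *)
(* monomials. Near t = alpha_j, f_i vanishes to order W(i), so that the initial   *)
(* form of g in the scaled variables f_i x_i is supported on S; and a polynomial  *)
(* with at most w ^ 2 monomials, shifted by nonzero constants, has a monomial of  *)
(* support at most log (w ^ 2).                                                   *)
(*                                                                                *)
(* An isolating weight is built by doubling the length of the blocks of           *)
(* consecutive variables: the products of two isolated sets have at most w ^ 4    *)
(* elements, and the Kronecker weights X ^ i mod m separate them for some small m *)
(* since the common multiples of 1, .., 2k + 1 exceed 2 ^ k. The moduli m of the  *)
(* log n + 1 levels are the digits of j in base B, and W_j is the number with     *)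
(* digits X ^ i mod m.                                                            *)

Require Import Defs.
From mathcomp Require Import all_boot all_order all_fingroup all_algebra.
From mathcomp Require Import zify ring.
Local Open Scope ring_scope.

Set Implicit Arguments.
Unset Strict Implicit.
Unset Printing Implicit Defensive.

Import GRing.Theory.

(** * Separating monomials by residues *)

Local Open Scope nat_scope.

(** Put f_i = prod_j (t - alpha_j) ^ W_j(i) for an explicit family of weight functions W_j. This
    tuple does not depend on A; only the index j used in the analysis does.

    Isolation. By [layered_product_coeff], the coefficient of x^a in A is P * prod E_i(a_i) * Q, so
    linear relations among products of w x w matrices pass to A. Say that W isolates a block of
    consecutive variables if some set S of at most w^2 monomials has this property: every other
    coefficient of the block is spanned by those of strictly lighter members of S. Concatenating two
    blocks multiplies their sets ([isolates_cat]), giving at most w^4 monomials. A new low-order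
    digit X^i mod m makes all weights on such a set distinct ([separating_modulus]), and a greedy
    choice by weight reduces the set to the dimension w^2 ([greedy_basis], [isolates_refine]). After
    about log n doublings one W_j isolates the whole order ([isolates_order]).

    Concentration. If the low-support coefficients of A(x + f) fail to span, a linear functional
    turns A into a scalar g whose shift has no low-support monomial but is nonzero. At t = alpha_j
    the lowest-order part of g, in the variables f_i x_i, lives on S. Shifting at most w^2 monomials
    by constants always produces a monomial of support at most log (w^2)
    ([sparse_shift_low_support]), a contradiction ([shift_low_support],
    [concentrated_of_isolating]).

    Computation. With Z the number of weights, a program built from counting loops writes each f_i
    as a row of Z^2 coefficients, multiplying in one linear factor at a time. Time plus output size
    is at most Z^6, which is quasi-polynomial ([runs_shift_program], [num_weights_le]). *)

Lemma leibniz_triangle_dvd (Q n k : nat) :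
  (forall m, 0 < m <= n.+1 -> m %| Q) -> k <= n -> n.+1 * 'C(n, k) %| Q.
Proof.
elim: k n => [|k IH] n hQ hk; first by rewrite bin0 muln1 hQ //=.
case: n hQ hk => // n hQ hk.
have hm m : 0 < m <= n.+1 -> m %| Q by move=> /andP[h1 h2]; apply: hQ; rewrite h1 ltnW.
have [a ea] := dvdnP (IH n hm hk).
have [b eb] := dvdnP (IH n.+1 hQ (ltnW hk)).
have p1 : 0 < 'C(n, k) by rewrite bin_gt0.
have p2 : 0 < 'C(n.+1, k) by rewrite bin_gt0 ltnW // ltnS.
have E1 : k.+1 * 'C(n.+1, k.+1) = n.+1 * 'C(n, k) by rewrite -mul_bin_diag.
have E2 : (n.+1 - k) * 'C(n.+1, k) = n.+1 * 'C(n, k).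
  by rewrite -mul_bin_down.
(* 1/((n+2)C(n+1,k+1)) = 1/((n+1)C(n,k)) - 1/((n+2)C(n+1,k)), times Q *)
apply/dvdnP; exists (a - b).
rewrite mulnBl.
have Ea : a * (n.+2 * 'C(n.+1, k.+1)) * k.+1 = n.+2 * Q.
  by rewrite ea; transitivity (a * n.+2 * (k.+1 * 'C(n.+1, k.+1))); [ring | rewrite E1; ring].
have Eb : b * (n.+2 * 'C(n.+1, k.+1)) * k.+1 = (n.+1 - k) * Q.
  rewrite {1}eb; transitivity (b * n.+2 * (k.+1 * 'C(n.+1, k.+1))); first by ring.
  by rewrite E1 -E2; ring.
have : (a * (n.+2 * 'C(n.+1, k.+1)) - b * (n.+2 * 'C(n.+1, k.+1))) * k.+1 = Q * k.+1.
  rewrite mulnBl Ea Eb -mulnBl mulnC; congr (_ * _); lia.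
by move/eqP; rewrite eqn_pmul2r // => /eqP.
Qed.

(** The middle entry of row 2k of the Leibniz triangle gives (2k + 1) * C(2k, k) as a divisor of Q,
    and C(2k, k) >= 2^k. *)
Lemma common_multiple_gt (Q k : nat) :
  0 < Q -> 0 < k -> (forall m, 0 < m <= k.*2.+1 -> m %| Q) -> 2 ^ k < Q.
Proof.
move=> Q0 k0 hQ.
have h := dvdn_leq Q0 (@leibniz_triangle_dvd Q k.*2 k hQ _).
have {}h : k.*2.+1 * 'C(k.*2, k) <= Q by apply: h; rewrite -addnn leq_addr.
apply: leq_trans h.
have : 2 ^ k <= 'C(k.*2, k).
  elim: k {k0 hQ} => // k IH.
  rewrite doubleS binS expnS mul2n -addnn leq_add //.
    by apply: leq_trans IH _; rewrite binS leq_addl.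
  by apply: leq_trans IH _; apply: leq_bin2l.
have : 0 < 2 ^ k by rewrite expn_gt0.
nia.
Qed.

Lemma kronecker_inj (D n : nat) (f g : 'I_n -> nat) :
  (forall i, f i < D) -> (forall i, g i < D) ->
  \sum_(i < n) D ^ i * f i = \sum_(i < n) D ^ i * g i -> f =1 g.
Proof.
elim: n f g => [|n IH] f g hf hg; first by move=> _ [].
rewrite !big_ord_recl !expn0 !mul1n.
have E h : \sum_(i < n) D ^ bump 0 i * h (lift ord0 i) =
    (\sum_(i < n) D ^ i * h (lift ord0 i)) * D.
  by rewrite big_distrl; apply: eq_bigr => i _; rewrite /= /bump add1n expnS; ring.
rewrite !E => e.
have e0 : f ord0 = g ord0.
  by have := congr1 (modn^~ D) e; rewrite /= !(addnC (_ ord0)) !modnMDl !modn_small.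
have D0 : 0 < D by apply: leq_ltn_trans (hf ord0).
have /IH e1 : \sum_(i < n) D ^ i * f (lift ord0 i) = \sum_(i < n) D ^ i * g (lift ord0 i).
  by apply/eqP; rewrite -(eqn_pmul2r D0); move/eqP: e; rewrite e0 eqn_add2l.
move=> i; case: (unliftP ord0 i) => [j|] -> //; exact: e1.
Qed.

(** Halving: two distinct members of S differ at some coordinate i, and the smaller of their two
    fibres over i has at most half of S. Recording i and recursing into that fibre costs one
    coordinate per halving. *)
Lemma isolating_coordinates (I T : finType) (S : {set {ffun I -> T}}) :
  S != set0 -> exists2 s, s \in S &
  exists J : {set I}, 2 ^ #|J| <= #|S| /\
    forall s', s' \in S -> {in J, s' =1 s} -> s' = s.
Proof.
move: {2}#|S| (leqnn #|S|) => N; elim: N S => [|N IH] S.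
  by rewrite leqn0 cards_eq0 => /eqP->; rewrite eqxx.
move=> hN S0; have [s1 s1S] := set0Pn _ S0.
have [[s2 s2S ne]|all1] := altP (exists_inP (P := [pred s | s != s1]) (D := mem S)); last first.
  exists s1 => //; exists set0; rewrite cards0 expn0 card_gt0 S0; split => // s' s'S _.
  by apply/eqP; apply: contraNT all1 => ne; apply/exists_inP; exists s'.
have [i hi] : exists i, s2 i != s1 i.
  apply/existsP; apply: contraR ne => /existsPn h; apply/eqP/ffunP => i.
  by apply/eqP; have := h i; rewrite negbK.
pose P x := [set s in S | s i == x].
have half x s : s \in S -> s i = x -> 2 * #|P x| <= #|S| ->
    exists2 s, s \in S & exists J : {set I}, 2 ^ #|J| <= #|S| /\
      forall s', s' \in S -> {in J, s' =1 s} -> s' = s.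
  move=> sS sx hP.
  have P0 : P x != set0 by apply/set0Pn; exists s; rewrite inE sS sx eqxx.
  have Pp : 0 < #|P x| by rewrite card_gt0.
  have /IH/(_ P0)[s0] : #|P x| <= N by lia.
  rewrite inE => /andP[s0S /eqP s0x] [J [hJ hu]].
  exists s0 => //; exists (i |: J); split.
    apply: leq_trans hP; rewrite cardsU1; case: (i \notin J).
      by rewrite add1n expnS leq_mul2l hJ orbT.
    by rewrite add0n; apply: leq_trans hJ _; lia.
  move=> s' s'S hs'; apply: hu; first by rewrite inE s'S hs' ?s0x ?eqxx // setU11.
  by move=> k kJ; apply: hs'; rewrite setU1r.
have dis : #|P (s1 i)| + #|P (s2 i)| <= #|S|.
  rewrite -cardsUI [P _ :&: _](_ : _ = set0) ?cards0 ?addn0; last first.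
    apply/setP => s; rewrite !inE; apply/negP => /andP[/andP[_ /eqP e1] /andP[_ /eqP e2]].
    by move: hi; rewrite -e1 -e2 eqxx.
  by apply/subset_leq_card/subsetP => s; rewrite !inE => /orP[] /andP[].
have [h|h] := leqP #|P (s1 i)| #|P (s2 i)|.
  by apply: (half _ s1) => //; lia.
by apply: (half _ s2) => //; lia.
Qed.

Local Open Scope ring_scope.

(** * Low-support monomials of shifted sparse polynomials *)

(** Exponent vectors of individual degree at most d, as a finite type so that sums and sets of
    monomials are finite. *)
Notation mon n d := {ffun 'I_n -> 'I_d.+1}.

Definition mon_supp (n d : nat) (b : mon n d) : {set 'I_n} := [set i | b i != ord0].

Definition mon_bin (n d : nat) (a b : mon n d) : nat := \prod_i 'C(a i, b i).

(* The functionals [sum_b delta_b 'C(a, b)] separate the exponents because       *)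
(* [x ^ a = ((x - 1) + 1) ^ a].                                                  *)
Lemma binomial_delta (R : comNzRingType) (d k : nat) (a : 'I_d.+1) :
  \sum_(b < d.+1) (('X - 1 : {poly R}) ^+ b)`_k * 'C(a, b)%:R = (k == a)%:R.
Proof.
have -> : (k == a)%:R = ('X^a : {poly R})`_k by rewrite coefXn.
have {2}-> : ('X : {poly R}) = 1 + ('X - 1) by rewrite addrC subrK.
rewrite exprDn coef_sum.
rewrite (big_ord_widen_cond d.+1 predT
  (fun i => ((1 ^+ (a - i) * ('X - 1 : {poly R}) ^+ i) *+ 'C(a, i))`_k)) //.
rewrite [RHS]big_mkcond; apply: eq_bigr => b _ /=.
rewrite expr1n mul1r coefMn mulr_natr.
by case: ltnP => // h; rewrite bin_small.
Qed.

(* Isolate some [s] of the support by at most log2 of its size coordinates, and   *)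
(* test with the product of the functionals of [binomial_delta] over them.        *)
Lemma sparse_shift_low_support (R : fieldType) (n d : nat) (e : mon n d -> R)
    (S : {set mon n d}) :
  (exists a, e a != 0) -> (forall a, a \notin S -> e a = 0) ->
  exists b, (2 ^ #|mon_supp b| <= #|S|)%N /\
    \sum_a (mon_bin a b)%:R * e a != 0.
Proof.
move=> [a0 ea0] hS; pose S' := [set a | e a != 0].
have S'0 : S' != set0 by apply/set0Pn; exists a0; rewrite inE.
have S'S : S' \subset S.
  by apply/subsetP => a; rewrite inE; apply: contraR => /hS->.
have [s sS' [J [hJ hu]]] := isolating_coordinates S'0.
(* Outside J the factor is the indicator of b_i = 0, which contributes C(a_i, 0) = 1 and confines
   the test to vectors b supported in J. *)
pose dl (i : 'I_n) (b : 'I_d.+1) : R :=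
  if i \in J then (('X - 1 : {poly R}) ^+ b)`_(s i) else (b == ord0)%:R.
have dlE a : \sum_(b : mon n d) (\prod_i dl i (b i)) * (mon_bin a b)%:R =
    [forall i in J, a i == s i]%:R.
  transitivity (\prod_i \sum_(b < d.+1) dl i b * 'C(a i, b)%:R).
    rewrite bigA_distr_bigA; apply: eq_bigr => b _.
    by rewrite natr_prod -big_split.
  transitivity (\prod_i ((i \in J) ==> (a i == s i))%:R : R).
    apply: eq_bigr => i _; rewrite /dl; case: (i \in J) => /=.
      by rewrite binomial_delta eq_sym.
    rewrite (bigD1 ord0) //= bin0 mulr1 ?eqxx big1 ?addr0 // => b /negPf->.
    by rewrite mul0r.
  case: forall_inP => [h|h] /=.
    by rewrite big1 // => i _; case iJ: (i \in J); rewrite //= h.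
  have [i hi] : exists i, ~~ ((i \in J) ==> (a i == s i)).
    apply/existsP; apply: contra_notT h => /existsPn h' i iJ.
    by have := h' i; rewrite negbK iJ.
  by rewrite (bigD1 i) //= (negPf hi) mul0r.
(* Among the monomials in the support of e, only s agrees with s on J, so the combined functional
   takes the value e(s). Some term b must then be nonzero. *)
have : \sum_(b : mon n d) (\prod_i dl i (b i)) * (\sum_a (mon_bin a b)%:R * e a) != 0.
  under eq_bigr do rewrite mulr_sumr.
  rewrite exchange_big /=.
  under eq_bigr => a _ do under eq_bigr => b _ do rewrite mulrA.
  under eq_bigr => a _ do rewrite -mulr_suml dlE.
  rewrite (bigD1 s) //= big1 ?addr0 => [|a ne].
    have -> : [forall i in J, s i == s i] by apply/forall_inP.
    by rewrite mul1r; move: sS'; rewrite inE.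
  have [->|ea] := eqVneq (e a) 0; first by rewrite mulr0.
  case: forall_inP => [h|_]; last by rewrite mul0r.
  by case/eqP: ne; apply: hu; rewrite ?inE // => i /h/eqP.
have [/existsP[b /andP[h1 h2]] _|/existsPn h] :=
  boolP [exists b : mon n d, (\prod_i dl i (b i) != 0) && (\sum_a (mon_bin a b)%:R * e a != 0)].
  exists b; split => //; apply: leq_trans (subset_leq_card S'S).
  apply: leq_trans hJ; rewrite leq_exp2l //; apply/subset_leq_card/subsetP => i.
  rewrite inE; apply: contraR => iJ; apply: contraNT h1 => bi.
  by rewrite (bigD1 i) //= /dl (negPf iJ) (negPf bi) mul0r.
rewrite big1 ?eqxx // => b _; apply/eqP; have := h b.
by rewrite mulf_eq0 negb_and !negbK.
Qed.

(** * Weights and separating moduli *)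

Definition mweight (n d : nat) (W : 'I_n -> nat) (s : mon n d) : nat :=
  \sum_i W i * s i.

Lemma mweight_kronecker_lt (X n d : nat) (s : mon n d) :
  (d < X)%N -> (mweight (fun i => X ^ i)%N s < X ^ n)%N.
Proof.
move=> dX.
have X0 : (0 < X ^ n)%N by rewrite expn_gt0 (leq_ltn_trans _ dX).
rewrite -(ltn_predK X0) ltnS predn_exp mulnC big_distrl /=.
apply: leq_sum => i _; rewrite leq_mul2l; apply/orP; right.
have := ltn_ord (s i); lia.
Qed.

(** If every m up to 2k + 1 caused a collision, each would divide a difference of two distinct
    Kronecker weights, hence the product Q of all of them. But Q has at most r * K^2 factors, each
    at most X^n <= 2^(X * n), so Q <= 2^k, against [common_multiple_gt]. *)
Lemma separating_modulus (X n d r K k : nat) (S : 'I_r -> {set mon n d}) :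
  (d < X)%N -> (0 < k)%N -> (X * n * r * K ^ 2 <= k)%N ->
  (forall a, #|S a| <= K)%N ->
  exists m, (0 < m <= k.*2.+1)%N /\
    forall a, {in S a &, injective (mweight (fun i : 'I_n => X ^ i %% m)%N)}.
Proof.
move=> dX k0 hk hK.
pose kap : mon n d -> nat := mweight (fun i => X ^ i)%N.
(* The absolute difference: one of the two truncated subtractions is zero. *)
pose df (p : mon n d * mon n d) := (kap p.1 - kap p.2 + (kap p.2 - kap p.1))%N.
pose Q := (\prod_(a < r) \prod_(p in setX (S a) (S a) | p.1 != p.2) df p)%N.
have X0 : (0 < X)%N by lia.
have kap_inj : injective kap.
  move=> s s' e; apply/ffunP => i; apply/val_inj.
  have lt (t : mon n d) j : (t j < X)%N by apply: leq_ltn_trans dX; rewrite -ltnS.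
  exact: (@kronecker_inj X n (fun j => s j) (fun j => s' j) (lt s) (lt s') e i).
have Q0 : (0 < Q)%N.
  rewrite prodn_gt0 // => a; rewrite prodn_cond_gt0 // => -[s s'] /= /andP[_ ne].
  rewrite /df /=; have : kap s != kap s' by apply: contra_neq ne => /kap_inj.
  lia.
have Qle : (Q <= 2 ^ k)%N.
  have h1 a : (\prod_(p in setX (S a) (S a) | p.1 != p.2) df p <= (X ^ n) ^ (K ^ 2))%N.
    apply: (@leq_trans (\prod_(p in setX (S a) (S a)) X ^ n)%N).
      rewrite big_mkcondr; apply: leq_prod => -[s s'] _ /=.
      have := mweight_kronecker_lt s dX; have := mweight_kronecker_lt s' dX.
      rewrite -/(kap s) -/(kap s') /df /=; case: ifP => _; lia.
    rewrite prod_nat_const cardsX leq_pexp2l ?expn_gt0 ?X0 //.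
    by rewrite -mulnn leq_mul.
  apply: (@leq_trans (\prod_(a < r) (X ^ n) ^ (K ^ 2))%N); first exact: leq_prod.
  rewrite prod_nat_const card_ord -!expnM.
  apply: (@leq_trans ((2 ^ X) ^ (n * (K ^ 2 * r)))%N).
    have [->|e0] := posnP (n * (K ^ 2 * r))%N; first by rewrite !expn0.
    by rewrite leq_exp2r; [exact: ltnW (ltn_expl _ _) | exact: e0].
  rewrite -expnM leq_exp2l //; apply: leq_trans hk; apply: eq_leq; ring.
pose good (m : nat) := [forall a : 'I_r, [forall s in S a, [forall s' in S a,
  (mweight (fun i : 'I_n => X ^ i %% m)%N s == mweight (fun i : 'I_n => X ^ i %% m)%N s')
    ==> (s == s')]]].
have [/existsP[m hm]|/existsPn h] := boolP [exists m : 'I_(k.*2.+1), good m.+1].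
  exists m.+1; split; first exact: ltn_ord.
  move=> a s s' sS s'S /eqP e; apply/eqP.
  by move/forallP: hm => /(_ a)/forall_inP/(_ s sS)/forall_inP/(_ s' s'S)/implyP; apply.
suff : (2 ^ k < Q)%N by rewrite ltnNge Qle.
apply: common_multiple_gt => // m /andP[m0 mk].
have : ~~ good m.
  by case: m m0 mk => // m _ mk; apply: (h (Ordinal mk)).
move=> /forallPn[a] /forall_inPn[s sS] /forall_inPn[s' s'S].
rewrite negb_imply => /andP[/eqP e ne].
have modE t : (kap t = mweight (fun i : 'I_n => X ^ i %% m)%N t %[mod m])%N.
  rewrite /kap /mweight; elim/big_rec2: _ => // i x y _ IH.
  by rewrite -modnDm IH -(modnMml (X ^ i)%N) modnDm.
have dv : (m %| df (s, s'))%N.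
  have {e} e : (kap s = kap s' %[mod m])%N by rewrite !modE e.
  rewrite /df /=; case: (leqP (kap s) (kap s')) => hh.
    by rewrite (eqP hh) add0n -eqn_mod_dvd // e.
  by have hh' := ltnW hh; rewrite (eqP hh') addn0 -eqn_mod_dvd // e.
apply: dvdn_trans dv _.
rewrite /Q (bigD1 a) //= dvdn_mulr // (bigD1 (s, s')) ?dvdn_mulr //=.
by rewrite inE /= sS s'S.
Qed.

(** * Greedy bases ordered by weight *)

Lemma memv_lincombP (F : fieldType) (vT : vectType F) (T : finType) (P : pred T)
    (C : T -> vT) (v : vT) :
  reflect (exists k : T -> F, v = \sum_(s | P s) k s *: C s)
          (v \in (\sum_(s | P s) <[C s]>)%VS).
Proof.
apply: (iffP memv_sumP) => [[vs hvs ->]|[k ->]]; last first.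
  by exists (fun s => k s *: C s) => // s _; rewrite memvZ ?memv_line.
have h s : exists x, P s -> vs s = x *: C s.
  have [Ps|_] := boolP (P s); last by exists 0.
  by have /vlineP[x ->] := hvs s Ps; exists x.
have [k hk] := fin_all_exists h.
by exists k; apply: eq_bigr => s /hk.
Qed.

(* Keep the elements outside the span of the lighter ones.                       *)
Lemma greedy_basis (F : fieldType) (vT : vectType F) (T : finType) (C : T -> vT)
    (W : T -> nat) (S' : {set T}) :
  {in S' &, injective W} ->
  exists S : {set T}, [/\ S \subset S', (#|S| <= \dim {:vT})%N,
    forall v, (\sum_(s in S' | (W s < v)%N) <[C s]> <=
               \sum_(s in S | (W s < v)%N) <[C s]>)%VS
  & forall s, s \in S' -> s \notin S ->
      C s \in (\sum_(s' in S' | (W s' < W s)%N) <[C s']>)%VS].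
Proof.
move=> inj; pose U v := (\sum_(s in S' | (W s < v)%N) <[C s]>)%VS.
pose S := [set s in S' | C s \notin U (W s)].
(* Induction on the weight threshold. Since W is injective on S', at most one element enters at each
   step; it is kept exactly when it raises the dimension of the span. *)
have key v : (U v <= \sum_(s in S | (W s < v)%N) <[C s]>)%VS /\
    (#|[set s in S | (W s < v)%N]| <= \dim (U v))%N.
  elim: v => [|v [IH1 IH2]].
    rewrite /U !big_pred0; try by move=> s; rewrite andbF.
    split; first exact: sub0v.
    by rewrite (_ : [set _ | _] = set0) ?cards0 //; apply/setP => s; rewrite !inE andbF.
  have mono : (\sum_(s in S | (W s < v)%N) <[C s]> <=
      \sum_(s in S | (W s < v.+1)%N) <[C s]>)%VS.
    apply/subv_sumP => s /andP[sS sv]; apply: (sumv_sup s) => //.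
    by rewrite sS ltnW.
  have [/existsP[s0 /andP[s0S /eqP Ws0]]|/existsPn none] :=
      boolP [exists s, (s \in S') && (W s == v)]; last first.
    have e s : s \in S' -> (W s < v.+1)%N = (W s < v)%N.
      by move=> sS; rewrite ltnS leq_eqVlt; have := none s; rewrite sS /= => /negPf->.
    have -> : U v.+1 = U v.
      by apply: eq_bigl => s; case sS: (s \in S') => //=; rewrite e.
    split; first exact: subv_trans mono.
    apply: leq_trans IH2; apply: subset_leq_card; apply/subsetP => s.
    by rewrite !inE => /andP[/andP[sS ->]]; rewrite e // sS.
  have UE : U v.+1 = (<[C s0]> + U v)%VS.
    rewrite /U (bigD1 s0) ?s0S ?Ws0 //=; congr (_ + _)%VS; apply: eq_bigl => s.
    case sS: (s \in S') => //=; rewrite ltnS leq_eqVlt.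
    have [->|ne] := eqVneq s s0; first by rewrite Ws0 eqxx ltnn.
    have -> : (W s == v) = false; last by rewrite andbT.
    by apply: contra_neqF ne => /eqP e; apply: inj => //; rewrite e Ws0.
  have [inU|ninU] := boolP (C s0 \in U v).
    have {}UE : U v.+1 = U v by rewrite UE; apply/addv_idPr.
    rewrite UE; split; first exact: subv_trans mono.
    apply: leq_trans IH2; apply: subset_leq_card; apply/subsetP => s.
    rewrite !inE ltnS leq_eqVlt => /andP[/andP[sS nin]].
    rewrite sS nin => /orP[/eqP e|-> //].
    have ss0 : s = s0 by apply: inj => //; rewrite e Ws0.
    by move: nin; rewrite ss0 Ws0 inU.
  split.
    rewrite UE subv_add (subv_trans IH1 mono) andbT.
    by apply: (sumv_sup s0) => //; rewrite inE s0S Ws0 ninU /= ltnS.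
  apply: (@leq_trans (\dim (U v)).+1).
    apply: (@leq_trans (#|[set s0]| + #|[set s in S | (W s < v)%N]|)%N); last first.
      by rewrite cards1 add1n ltnS.
    apply: leq_trans (leq_card_setU _ _).
    apply: subset_leq_card; apply/subsetP => s.
    rewrite !inE ltnS leq_eqVlt => /andP[/andP[sS nin]].
    rewrite sS nin => /orP[/eqP e|->]; last by rewrite orbT.
    by rewrite (inj s s0) ?eqxx // e Ws0.
  have : (U v <= U v.+1)%VS by rewrite UE addvSr.
  move=> sub; rewrite ltn_neqAle dimvS // andbT; apply: contraNneq ninU => e.
  have /eqP-> : U v == U v.+1 by rewrite eqEdim sub e leqnn.
  by rewrite UE memvE addvSl.
exists S; split.
- by apply/subsetP => s; rewrite inE => /andP[].
- pose N := (\max_s W s).+1.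
  have [_ h] := key N; apply: leq_trans (dimvS (subvf (U N))).
  apply: leq_trans h; apply: subset_leq_card; apply/subsetP => s sS.
  by rewrite !inE in sS *; rewrite sS /= ltnS leq_bigmax.
- by move=> v; case: (key v).
- by move=> s sS'; rewrite inE sS' negbK.
Qed.

(** * Isolating weights for ordered products *)

Local Open Scope ring_scope.

(** One number j encodes the moduli of all levels. A base-B digit r stands for the modulus r + 1, so
    no modulus is zero. *)
Definition digit_weight (X B lev j i : nat) : nat :=
  (\sum_(l < lev) B ^ l * (X ^ i %% ((j %/ B ^ l) %% B).+1))%N.

(** A further level enters as the lowest digit, so comparisons decided by earlier levels keep
    priority. *)
Lemma digit_weightS (X B lev j r i : nat) : (r < B)%N ->
  digit_weight X B lev.+1 (B * j + r) i =
  (B * digit_weight X B lev j i + X ^ i %% r.+1)%N.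
Proof.
move=> rB; have B0 : (0 < B)%N by apply: leq_ltn_trans rB.
rewrite /digit_weight big_ord_recl expn0 mul1n divn1 mulnC.
rewrite modnMDl (modn_small rB) addnC; congr (_ + _)%N.
rewrite big_distrr; apply: eq_bigr => l _ /=.
rewrite /bump add1n expnS mulnA; congr (_ * (_ %% (_ %% _).+1))%N.
by rewrite divnMA divnMDl // (divn_small rB) addn0.
Qed.

Lemma digit_weight_lt (X B lev j i : nat) :
  (0 < B)%N -> (digit_weight X B lev j i < B ^ lev)%N.
Proof.
move=> B0; rewrite -(@ltn_predK 0 (B ^ lev)) ?expn_gt0 ?B0 // ltnS predn_exp.
rewrite big_distrr; apply: leq_sum => l _ /=; rewrite mulnC leq_mul2r; apply/orP; right.
have h1 := ltn_pmod (X ^ i) (ltn0Sn ((j %/ B ^ l) %% B)).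
have h2 := ltn_pmod (j %/ B ^ l) B0; lia.
Qed.

Section Isolation.
Variables (F : fieldType) (n d w : nat) (E : 'I_n -> nat -> 'M[F]_w).
Implicit Types (u : seq 'I_n) (a s : mon n d) (W : 'I_n -> nat).

(** With [E i k] the coefficient of x_i^k in the layer of x_i, this is the coefficient of x^a in the
    product of the layers of u. *)
Definition block_coeff u a : 'M[F]_w := \prod_(i <- u) E i (a i).

Definition supported u a : bool := [forall i, (i \notin u) ==> (a i == ord0)].

Definition restrict u a : mon n d := [ffun i => if i \in u then a i else ord0].

Definition join u a1 a2 : mon n d := [ffun i => if i \in u then a1 i else a2 i].

Definition isolates_in W u (S : {set mon n d}) : Prop :=
  (forall s, s \in S -> supported u s) /\
  forall a, supported u a -> a \notin S ->
    block_coeff u a \in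
      (\sum_(s in S | (mweight W s < mweight W a)%N) <[block_coeff u s]>)%VS.

Definition isolates W u : Prop :=
  exists S : {set mon n d}, (#|S| <= w ^ 2)%N /\ isolates_in W u S.

Lemma supportedP u a : reflect (forall i, i \notin u -> a i = ord0) (supported u a).
Proof.
apply: (iffP forallP) => h i; last by apply/implyP => /h ->.
by move=> iu; apply/eqP/(implyP (h i)).
Qed.

Lemma supported_restrict u a : supported u (restrict u a).
Proof. by apply/supportedP => i iu; rewrite ffunE (negPf iu). Qed.

(** Brings a larger isolated set back to size w^2. Spanning by lighter elements survives because W'
    refines W, and the greedy basis of S' replaces its elements by lighter basis elements; the w x w
    matrices have dimension w^2. *)
Lemma isolates_refine W W' u S' :
  isolates_in W u S' ->
  (forall a a', (mweight W a < mweight W a')%N -> (mweight W' a < mweight W' a')%N) ->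
  {in S' &, injective (@mweight n d W')} ->
  isolates W' u.
Proof.
move=> [supp span] mono inj.
have [S [SS' hS sub hin]] := greedy_basis (block_coeff u) inj.
exists S; split; first by move: hS; rewrite dimvf /dim /= mulnn.
split=> [s /(subsetP SS')/supp//|a ua aS].
apply: (subvP (sub _)).
have [aS'|aS'] := boolP (a \in S'); first exact: hin.
apply: subvP (span a ua aS').
apply/subv_sumP => s /andP[sS' sa]; apply: (sumv_sup s) => //.
by rewrite sS' mono.
Qed.

Lemma mweight_join W u1 u2 a1 a2 :
  {in u2, forall i, i \notin u1} -> supported u1 a1 -> supported u2 a2 ->
  mweight W (join u1 a1 a2) = (mweight W a1 + mweight W a2)%N.
Proof.
move=> dis /supportedP h1 /supportedP h2; rewrite /mweight -big_split.
apply: eq_bigr => i _; rewrite ffunE /= -mulnDr; congr (_ * _)%N.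
case: ifP => iu; last by rewrite h1 ?iu.
by rewrite h2 ?addn0 //; apply: contraTN iu => /dis.
Qed.

Lemma block_coeff_join u1 u2 a1 a2 :
  {in u2, forall i, i \notin u1} ->
  block_coeff (u1 ++ u2) (join u1 a1 a2) = block_coeff u1 a1 * block_coeff u2 a2.
Proof.
move=> dis; rewrite /block_coeff big_cat; congr (_ * _).
  by apply: eq_big_seq => i iu; rewrite ffunE iu.
by apply: eq_big_seq => i /dis iu; rewrite ffunE (negPf iu).
Qed.

(* A coefficient of the product of two blocks expands along the products of the  *)
(* two isolated sets, and only its own monomial can reach its weight.            *)
Lemma isolates_cat W u1 u2 :
  {in u2, forall i, i \notin u1} -> isolates W u1 -> isolates W u2 ->
  exists S : {set mon n d}, (#|S| <= (w ^ 2) ^ 2)%N /\ isolates_in W (u1 ++ u2) S.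
Proof.
move=> dis [S1 [c1 [s1 h1]]] [S2 [c2 [s2 h2]]].
exists [set join u1 a1 a2 | a1 in S1, a2 in S2]; split.
  rewrite curry_imset2X; apply: leq_trans (leq_imset_card _ _) _.
  by rewrite cardsX -mulnn leq_mul.
split=> [s /imset2P[a1 a2 /s1/supportedP ha1 /s2/supportedP ha2 ->]|a ua aS].
  apply/supportedP => i; rewrite mem_cat negb_or => /andP[i1 i2].
  by rewrite ffunE (negPf i1) ha2.
have expand u (S : {set mon n d}) a' :
    (forall a, supported u a -> a \notin S -> block_coeff u a \in
      (\sum_(s in S | (mweight W s < mweight W a)%N) <[block_coeff u s]>)%VS) ->
    supported u a' ->
    block_coeff u a' \in (\sum_(s in S | (s == a') || (mweight W s < mweight W a')%N)
      <[block_coeff u s]>)%VS.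
  move=> h ua'; have [aS'|/(h _ ua')] := boolP (a' \in S).
    by rewrite memvE; apply: (sumv_sup a') => //; rewrite aS' eqxx.
  apply: subvP; apply/subv_sumP => s /andP[sS sa]; apply: (sumv_sup s) => //.
  by rewrite sS sa orbT.
have aE : a = join u1 (restrict u1 a) (restrict u2 a).
  apply/ffunP => i; rewrite !ffunE; case i1: (i \in u1) => //; case i2: (i \in u2) => //.
  by move/supportedP: ua; apply; rewrite mem_cat i1 i2.
have r1 := supported_restrict u1 a; have r2 := supported_restrict u2 a.
have /memv_lincombP[k1 e1] := expand _ _ _ h1 r1.
have /memv_lincombP[k2 e2] := expand _ _ _ h2 r2.
rewrite {1}aE block_coeff_join // e1 e2 mulr_suml.
apply: memv_suml => t1 /andP[t1S t1w]; rewrite mulr_sumr.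
apply: memv_suml => t2 /andP[t2S t2w].
have -> : (k1 t1 *: block_coeff u1 t1) * (k2 t2 *: block_coeff u2 t2) =
    (k1 t1 * k2 t2) *: (block_coeff u1 t1 * block_coeff u2 t2).
  by rewrite -[LHS]/(_ *m _) -scalemxAl -scalemxAr scalerA.
rewrite memvZ // -block_coeff_join // memvE.
have tS : join u1 t1 t2 \in [set join u1 a1 a2 | a1 in S1, a2 in S2] by exact: imset2_f.
apply: (sumv_sup (join u1 t1 t2)) => //.
rewrite tS /= [in ltnRHS]aE (mweight_join _ dis (s1 _ t1S) (s2 _ t2S))
  (mweight_join _ dis r1 r2).
(* Both factors being the restrictions of a would put a into the product set. Hence at least one
   factor is strictly lighter, and so is the join. *)
have [e|ne] := eqVneq (t1, t2) (restrict u1 a, restrict u2 a).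
  by case: e tS => -> ->; rewrite -aE (negPf aS).
case/orP: t1w => [/eqP t1E|t1w]; case/orP: t2w => [/eqP t2E|t2w].
- by rewrite t1E t2E eqxx in ne.
- by rewrite t1E ltn_add2l.
- by rewrite t2E ltn_add2r.
- by rewrite -addnS leq_add // ltnW.
Qed.

Lemma isolates_nil W : (0 < w)%N -> isolates W [::].
Proof.
move=> w0; exists [set a | supported [::] a]; split; last first.
  by split=> [s|a]; rewrite inE // => ->.
apply: leq_trans (_ : 1 <= _)%N; last by rewrite expn_gt0 w0.
rewrite -(cards1 (restrict [::] [ffun=> ord0])); apply: subset_leq_card.
apply/subsetP => a; rewrite !inE => /supportedP h; apply/eqP/ffunP => i.
by rewrite ffunE h.
Qed.

Lemma card_supported_le1 u : (size u <= 1)%N -> (#|[set a | supported u a]| <= d.+1)%N.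
Proof.
move=> su; pose i0 : option 'I_n := ohead u.
have : {in [set a | supported u a] &, injective (fun a => oapp a ord0 i0)}.
  move=> a b; rewrite !inE => /supportedP ha /supportedP hb e; apply/ffunP => i.
  have [iu|iu] := boolP (i \in u); last by rewrite ha ?hb.
  by move: su iu e; rewrite /i0; case: (u) => [|j [|]] //= _; rewrite inE => /eqP->.
by move/card_in_imset <-; apply: leq_trans (max_card _) _; rewrite card_ord.
Qed.

(** Windows start at every position p, not only at multiples of 2^l, and may be cut short by the end
    of v; n starting positions cover all nonempty ones. *)
Definition window (v : seq 'I_n) (l p : nat) : seq 'I_n := take (2 ^ l) (drop p v).

Lemma windowS v l p : window v l.+1 p = window v l p ++ window v l (2 ^ l + p).
Proof. by rewrite /window expnS mul2n -addnn takeD drop_drop. Qed.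

Variables (X B k : nat).
Hypotheses (w0 : (0 < w)%N) (k0 : (0 < k)%N) (dX : (d < X)%N).
(** Sets to be separated have at most w^4 elements (two joined blocks) or d + 1 (a single variable),
    and there are n windows. The next two bounds make the new digit carry-free and let the modulus
    fit into one base-B digit. *)
Hypothesis kX : (X * n * n * (maxn (w ^ 4) d.+1) ^ 2 <= k)%N.
Hypothesis kB : (n * d * k.*2.+1 < B)%N.
Hypothesis kB1 : (k.*2.+1 <= B)%N.

(** A single modulus serves all n blocks at once. The added part of a monomial's weight stays below
    B, so strict inequalities for W persist, and reduction mod B recovers the separating weight. *)
Lemma refine_family W (U : nat -> seq 'I_n) (S : 'I_n -> {set mon n d}) :
  (forall p, (#|S p| <= maxn (w ^ 4) d.+1)%N) ->
  (forall p : 'I_n, isolates_in W (U p) (S p)) ->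
  exists m, (0 < m <= B)%N /\
    forall p : 'I_n, isolates (fun i => B * W i + X ^ i %% m)%N (U p).
Proof.
move=> cS iS.
have [m [/andP[m0 mk] inj]] := separating_modulus dX k0 kX cS.
exists m; split; first by rewrite m0 (leq_trans mk).
move=> p.
have wE (s : mon n d) : mweight (fun i => B * W i + X ^ i %% m)%N s =
    (B * mweight W s + mweight (fun i : 'I_n => X ^ i %% m)%N s)%N.
  rewrite /mweight big_distrr -big_split; apply: eq_bigr => i _ /=.
  by rewrite mulnDl mulnA.
have lt (s : mon n d) : (mweight (fun i : 'I_n => X ^ i %% m)%N s < B)%N.
  apply: leq_ltn_trans kB; apply: (@leq_trans (\sum_(i < n) m * d)%N).
    apply: leq_sum => i _; apply: leq_mul; first by rewrite ltnW // ltn_pmod.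
    by rewrite -ltnS.
  by rewrite sum_nat_const card_ord -mulnA leq_mul2l mulnC leq_mul2l mk !orbT.
apply: isolates_refine (iS p) _ _.
  move=> s s' h; rewrite !wE.
  have : (B * (mweight W s).+1 <= B * mweight W s')%N by rewrite leq_mul2l h orbT.
  by have := lt s; rewrite mulnS; lia.
move=> s s' sS s'S; rewrite !wE => e; apply: (inj p) => //.
have B0 : (0 < B)%N by apply: leq_ltn_trans (lt s).
have := congr1 (modn^~ B) e.
by rewrite /= ![(B * _)%N]mulnC !modnMDl !modn_small ?lt.
Qed.

Lemma refine_windows (v : seq 'I_n) (l lev j : nat) :
  size v = n -> (j < B ^ lev)%N ->
  (forall p, exists S : {set mon n d}, (#|S| <= maxn (w ^ 4) d.+1)%N /\
     isolates_in (digit_weight X B lev j) (window v l p) S) ->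
  exists j', (j' < B ^ lev.+1)%N /\
    forall p, isolates (digit_weight X B lev.+1 j') (window v l p).
Proof.
move=> sv hj h.
have /fin_all_exists[S hS] : forall p : 'I_n, exists S : {set mon n d},
    (#|S| <= maxn (w ^ 4) d.+1)%N /\
     isolates_in (digit_weight X B lev j) (window v l p) S by move=> p; exact: h.
have [m [/andP[m0 mB] hm]] := refine_family (fun p => (hS p).1) (fun p => (hS p).2).
(* The digit is m - 1 because [digit_weight] adds one to every digit. *)
exists (B * j + m.-1)%N; split.
  rewrite expnS; apply: leq_trans (_ : B * j.+1 <= _)%N; last by rewrite leq_mul2l hj orbT.
  by rewrite mulnS addnC ltn_add2r prednK.
move=> p; have [np|pn] := leqP n p.
  by rewrite /window drop_oversize ?sv //=; apply: isolates_nil.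
have [S' [c [i1 i2]]] := hm (Ordinal pn).
have wE (s : mon n d) : mweight (digit_weight X B lev.+1 (B * j + m.-1)) s =
    mweight (fun i : 'I_n => B * digit_weight X B lev j i + X ^ i %% m)%N s.
  by apply: eq_bigr => i _; rewrite digit_weightS ?prednK.
exists S'; split => //; split => // s us sS.
by rewrite wE; under eq_bigl => t do rewrite wE; exact: i2.
Qed.

(** At length 1 all d + 1 monomials may be kept and the first digit separates them, starting from
    the zero weight. Each doubling then joins two adjacent windows and spends one more digit. *)
Lemma isolates_windows (v : seq 'I_n) (l : nat) :
  uniq v -> size v = n ->
  exists j, (j < B ^ l.+1)%N /\
    forall p, isolates (digit_weight X B l.+1 j) (window v l p).
Proof.
move=> uv sv; elim: l => [|l [j [hj hw]]].
  apply: (@refine_windows _ _ _ 0) => // p.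
  exists [set s | supported (window v 0 p) s]; split.
    by rewrite leq_max card_supported_le1 ?orbT // size_take_min geq_minl.
  by split=> [s|s]; rewrite inE // => ->.
apply: (refine_windows sv hj) => p; rewrite windowS.
have dis : {in window v l (2 ^ l + p), forall i, i \notin window v l p}.
  move=> i i2; apply/negP => i1.
  have : uniq (window v l.+1 p) by rewrite take_uniq // drop_uniq.
  rewrite windowS cat_uniq => /and3P[_ /hasPn/(_ i i2) /=].
  by rewrite i1.
have [S [c iS]] := isolates_cat dis (hw _) (hw _).
by exists S; split => //; rewrite leq_max -(expnM w 2 2) in c *; rewrite c.
Qed.

Lemma isolates_order (v : seq 'I_n) (l : nat) :
  uniq v -> size v = n -> (n <= 2 ^ l)%N ->
  exists j, (j < B ^ l.+1)%N /\ isolates (digit_weight X B l.+1 j) v.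
Proof.
move=> uv sv nl; have [j [hj /(_ 0)]] := isolates_windows l uv sv.
by rewrite /window drop0 take_oversize ?sv //; exists j.
Qed.
End Isolation.

(** * Coefficients of shifted polynomials and of branching programs *)

Local Open Scope ring_scope.

Definition mnm_of (n d : nat) (a : mon n d) : 'X_{1..n} := [multinom a i : nat | i < n].

Lemma mnm_of_inj (n d : nat) : injective (@mnm_of n d).
Proof.
move=> a b e; apply/ffunP => i; apply/val_inj.
by have := congr1 (fun m : 'X_{1..n} => m i) e; rewrite /mnm_of !mnmE.
Qed.

Lemma mnm_ofP (n d : nat) (m : 'X_{1..n}) :
  (forall i, (m i <= d)%N) -> exists a : mon n d, m = mnm_of a.
Proof.
move=> h; exists [ffun i => inord (m i)]; apply/mnmP => i.
by rewrite mnmE ffunE inordK // ltnS.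
Qed.

Lemma mnm_supp_mnm_of (n d : nat) (a : mon n d) : mnm_supp (mnm_of a) = #|mon_supp a|.
Proof. by apply: eq_card => i; rewrite !inE mnmE. Qed.

Lemma mpoly_bounded (R : nzRingType) (n d : nat) (p : {mpoly R[n]}) :
  (forall m, m \in msupp p -> forall i, (m i <= d)%N) ->
  p = \sum_(a : mon n d) p@_(mnm_of a) *: 'X_[mnm_of a].
Proof.
move=> h; apply/mpolyP => m; rewrite raddf_sum /=.
under eq_bigr do rewrite mcoeffZ mcoeffX.
have [mp|mp] := boolP (m \in msupp p).
  have [a ->] := mnm_ofP (h m mp).
  rewrite (bigD1 a) //= eqxx mulr1 big1 ?addr0 // => b ba.
  by rewrite (inj_eq (@mnm_of_inj _ _)) (negPf ba) mulr0.
rewrite (memN_msupp_eq0 mp) big1 // => a _.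
by have [->|_] := eqVneq; rewrite ?mulr0 // (memN_msupp_eq0 mp) mul0r.
Qed.

(** The vector b is arbitrary: where b_i > a_i the truncated exponent is harmless, since the
    binomial vanishes. *)
Lemma mcoeff_prod_shift (R : comNzRingType) (n d : nat) (c : 'I_n -> R) (a : mon n d)
    (b : 'X_{1..n}) :
  (\prod_i ('X_i + (c i)%:MP) ^+ a i)@_b =
  \prod_i (c i ^+ (a i - b i) *+ 'C(a i, b i)).
Proof.
have -> : \prod_i ('X_i + (c i)%:MP) ^+ a i =
   \sum_(g : mon n d) (\prod_i (c i ^+ (a i - g i) *+ 'C(a i, g i))) *: 'X_[mnm_of g].
  transitivity (\prod_i \sum_(j < d.+1) (c i ^+ (a i - j) *+ 'C(a i, j)) *: 'X_i ^+ j
      : {mpoly R[n]}).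
    apply: eq_bigr => i _; rewrite addrC exprDn.
    rewrite (big_ord_widen_cond d.+1 predT
      (fun j => ((c i)%:MP ^+ (a i - j) * 'X_i ^+ j : {mpoly R[n]}) *+ 'C(a i, j))) //.
    rewrite big_mkcond; apply: eq_bigr => j _ /=.
    case: ltnP => [_|h]; last by rewrite bin_small // mulr0n scale0r.
    by rewrite -rmorphXn /= mul_mpolyC scalerMnl.
  rewrite bigA_distr_bigA; apply: eq_bigr => g _.
  rewrite mpolyXE_id scaler_prod; congr (_ *: _).
  by apply: eq_bigr => i _; rewrite mnmE.
rewrite raddf_sum /=; under eq_bigr do rewrite mcoeffZ mcoeffX.
have [/existsP[i hi]|/existsPn hb] := boolP [exists i, (d < b i)%N].
  rewrite [RHS](bigD1 i) //= bin_small ?mulr0n ?mul0r; last first.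
    by apply: leq_ltn_trans hi; rewrite -ltnS.
  rewrite big1 // => g _; case: eqP => [e|_]; rewrite ?mulr0 //.
  by move: hi; rewrite -e mnmE ltnNge -ltnS ltn_ord.
have [|g ->] := @mnm_ofP n d b; first by move=> i; rewrite leqNgt hb.
rewrite (bigD1 g) //= eqxx mulr1 [X in _ + X]big1 ?addr0 => [|g' ne]; last first.
  by rewrite (inj_eq (@mnm_of_inj _ _)) (negPf ne) mulr0.
by apply: eq_bigr => i _; rewrite mnmE.
Qed.

Lemma mx_coeff_shift (F : fieldType) (n r c d : nat) (f : n.-tuple {poly F})
    (A : 'M[{mpoly F[n]}]_(r, c)) (b : 'X_{1..n}) :
  individual_degree_le d A ->
  mx_coeff (shift f A) b = \sum_(a : mon n d)
    (\prod_i (tnth f i ^+ (a i - b i) *+ 'C(a i, b i))) *: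
      map_mx polyC (mx_coeff A (mnm_of a)).
Proof.
move=> hA; apply/matrixP => i j; rewrite summxE /mx_coeff /shift !mxE.
have -> : map_mpoly polyC (A i j) =
    \sum_(a : mon n d) ((A i j)@_(mnm_of a))%:P *: 'X_[mnm_of a].
  apply/mpolyP => m; rewrite mcoeff_map_mpoly {1}(mpoly_bounded (hA i j)).
  rewrite !raddf_sum; apply: eq_bigr => a _.
  by rewrite /= !mcoeffZ !mcoeffX; case: eqP; rewrite ?mulr1 ?mulr0 ?polyC0.
rewrite (raddf_sum (comp_mpoly _)) raddf_sum; apply: eq_bigr => a _; rewrite /= !mxE.
rewrite comp_mpolyZ mcoeffZ comp_mpolyX mulrC; congr (_ * _).
rewrite -mcoeff_prod_shift; congr (_@__); apply: eq_bigr => k _.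
by rewrite tnth_mktuple mnmE.
Qed.

(** * Coefficients of products of univariate layers *)

Lemma mcoeff_mul_univariate (R : comNzRingType) (n : nat) (i : 'I_n) (p q : {mpoly R[n]})
    (a : 'X_{1..n}) :
  (forall m, m \in msupp p -> forall j, j != i -> m j = 0%N) ->
  (forall m, m \in msupp q -> m i = 0%N) ->
  (p * q)@_a = p@_[multinom (if j == i then a j else 0%N) | j < n] *
               q@_[multinom (if j == i then 0%N else a j) | j < n].
Proof.
move=> hp hq; set a1 := (X in p@_X); set a2 := (X in q@_X).
have aE : a = (a1 + a2)%MM.
  by apply/mnmP => j; rewrite mnmDE !mnmE; case: eqP; rewrite ?addn0.
rewrite [p in LHS]mpolyE mulr_suml raddf_sum /=.
have key m : m \in msupp p -> (p@_m *: 'X_[m] * q)@_a = p@_m * q@_a2 *+ (m == a1).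
  move=> mp; rewrite -scalerAl mcoeffZ mulrC -(mulrC q).
  have [->|ne] := eqVneq m a1; first by rewrite aE mcoeffMX mulr1n mulrC.
  rewrite mulr0n [(q * _)@_a](_ : _ = 0) ?mul0r //.
  rewrite mcoeffM big1 // => -[k1 k2] /= /eqP e; rewrite mcoeffX.
  have [e2|_] := eqVneq; last by rewrite mulr0.
  have [k1q|k1q] := boolP (bmnm k1 \in msupp q); last by rewrite (memN_msupp_eq0 k1q) mul0r.
  case/eqP: ne; apply/mnmP => j; rewrite mnmE.
  have [->|ji] := eqVneq j i; last by rewrite hp.
  by rewrite e mnmDE (hq _ k1q) add0n e2.
rewrite big_seq (eq_bigr _ key) -big_seq.
have [a1p|a1p] := boolP (a1 \in msupp p); last first.
  rewrite (memN_msupp_eq0 a1p) mul0r big_seq big1 // => m mp.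
  by case: eqP a1p => [<-|]; rewrite ?mp.
rewrite (bigD1_seq a1) ?msupp_uniq //= eqxx mulr1n big1 ?addr0 // => m /negPf->.
by rewrite mulr0n.
Qed.

Definition mnm1 (n : nat) (i : 'I_n) (k : nat) : 'X_{1..n} :=
  [multinom (if j == i then k else 0%N) | j < n].

Lemma mx_coeff_mulmx_univariate (R : comNzRingType) (n r w c : nat) (i : 'I_n)
    (D : 'M[{mpoly R[n]}]_(r, w)) (B : 'M[{mpoly R[n]}]_(w, c)) (a : 'X_{1..n}) :
  univariate_in i D ->
  (forall x y m, m \in msupp (B x y) -> m i = 0%N) ->
  mx_coeff (D *m B) a = mx_coeff D (mnm1 i (a i)) *m
    mx_coeff B [multinom (if j == i then 0%N else a j) | j < n].
Proof.
move=> hD hB; apply/matrixP => x y; rewrite !mxE raddf_sum /=.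
apply: eq_bigr => z _; rewrite !mxE (mcoeff_mul_univariate (i := i)) //; last first.
- exact: hB.
- exact: hD.
congr (_@__ * _); apply/mnmP => j; rewrite !mnmE.
by case: eqP => // ->.
Qed.

(* The identity is inserted as [pid_mx *m pid_mx] to make all layers square.     *)
Lemma layered_product_coeff (R : fieldType) (n w c : nat) (s : seq 'I_n) (r : nat)
    (A : 'M[{mpoly R[n]}]_(r, c)) :
  (r <= w)%N -> (c <= w)%N -> uniq s -> layered_product w s A ->
  exists (P : 'M[R]_(r, w)) (E : 'I_n -> nat -> 'M[R]_w) (Q : 'M[R]_(w, c)),
    forall a : 'X_{1..n}, mx_coeff A a =
      if [forall j, (j \notin s) ==> (a j == 0%N)]
      then P *m (\prod_(i <- s) E i (a i)) *m Q else 0.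
Proof.
move=> + cw; elim: s r A => // i s IH r A rw /= /andP[nis us].
have pidr : (pid_mx r : 'M[R]_(r, w)) *m (pid_mx r : 'M_(w, r)) = 1%:M.
  by rewrite pid_mx_id // pid_mx_1.
have pidc : (pid_mx c : 'M[R]_(c, w)) *m (pid_mx c : 'M_(w, c)) = 1%:M.
  by rewrite pid_mx_id // pid_mx_1.
case: s IH nis us => [|i' s] IH nis us.
  move=> hA; exists (pid_mx r : 'M_(r, w)).
  exists (fun _ k => (pid_mx r : 'M_(w, r)) *m mx_coeff A (mnm1 i k) *m (pid_mx c : 'M_(c, w))).
  exists (pid_mx c : 'M_(w, c)) => a; rewrite big_seq1.
  case: forallP => [h|h].
    rewrite !mulmxA pidr mul1mx -mulmxA pidc mulmx1; congr (mx_coeff A _).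
    apply/mnmP => j; rewrite mnmE; case: eqP => [-> //|/eqP ji].
    by apply/eqP; have := h j; rewrite inE ji.
  apply/matrixP => x y; rewrite !mxE; apply: memN_msupp_eq0; apply/negP => am.
  case: h => j; apply/implyP; rewrite inE => ji; apply/eqP.
  exact: hA am _ ji.
move=> [D [B [hD hB ->]]].
have [P' [E' [Q' h]]] := IH w B (leqnn w) us hB.
(* The coefficient formula for B already shows that it involves only variables of the remaining
   order, where i does not recur. *)
have Bi x y m : m \in msupp (B x y) -> m i = 0%N.
  rewrite mcoeff_msupp; apply: contraNeq => mi.
  have := h m; case: forallP => [hm _|_ /matrixP/(_ x y)]; last by rewrite !mxE => ->.
  by have := hm i; rewrite nis (negPf mi).
exists (pid_mx r : 'M_(r, w)).
exists (fun j k => if j == i then (pid_mx r : 'M_(w, r)) *m mx_coeff D (mnm1 i k) *m P' else E' j k).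
exists Q' => a; rewrite (mx_coeff_mulmx_univariate a hD Bi) h.
have -> : [forall j, (j \notin i' :: s) ==>
    ([multinom (if j == i then 0%N else a j) | j < n] j == 0%N)] =
    [forall j, (j \notin [:: i, i' & s]) ==> (a j == 0%N)].
  apply: eq_forallb => j; rewrite mnmE [in RHS]inE.
  by case: (j == i); rewrite //= implybT.
case: ifP => _; last by rewrite mulmx0.
rewrite [in RHS]big_cons /= ?eqxx -[X in _ = pid_mx r *m X *m _]/(_ *m _).
rewrite !mulmxA pidr mul1mx; congr (_ *m _ *m _).
apply: eq_big_seq => j js; rewrite mnmE.
by case: eqP => // ji; rewrite -ji js in nis.
Qed.

(** * From isolating weights to concentration *)

Lemma factor_out_root (F : fieldType) (T : finType) (G : T -> {poly F}) (al : F) :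
  (exists a, G a != 0) ->
  exists (v : nat) (G' : T -> {poly F}),
    (forall a, G a = ('X - al%:P) ^+ v * G' a) /\ exists a, (G' a).[al] != 0.
Proof.
move=> [a1 ha1]; move: {2}(size (G a1)) (leqnn (size (G a1))) => N.
elim: N G ha1 => [|N IH] G ha1; first by rewrite leqn0 size_poly_eq0 (negPf ha1).
move=> hN; have [/existsP[a ha]|/existsPn h] := boolP [exists a, (G a).[al] != 0].
  by exists 0%N, G; split; [move=> b; rewrite expr0 mul1r | exists a].
have hd a : exists q, G a = ('X - al%:P) * q.
  have /factor_theorem[q ->] : root (G a) al by apply/rootP/eqP; have := h a; rewrite negbK.
  by exists q; rewrite mulrC.
have [G1 hG1] := fin_all_exists hd.
have ne : G1 a1 != 0 by apply: contraNneq ha1 => e; rewrite hG1 e mulr0.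
have [|v [G' [hG' ha]]] := IH G1 ne.
  by move: hN; rewrite hG1 mulrC size_Mmonic ?monicXsubC // size_XsubC addn2.
by exists v.+1, G'; split => // a; rewrite hG1 hG' exprS mulrA.
Qed.

(* The initial form of [sum_a g_a x ^ a] under [x_i -> f_i x_i], for the order of *)
(* vanishing at [al], only involves monomials of [S]; hence it is sparse.        *)
Lemma shift_low_support (F : fieldType) (n d : nat) (W : 'I_n -> nat) (al : F)
    (f q : 'I_n -> {poly F}) (S : {set mon n d}) (g : mon n d -> {poly F}) :
  (forall i, f i = ('X - al%:P) ^+ W i * q i) -> (forall i, (q i).[al] != 0) ->
  (exists a, g a != 0) ->
  (forall a, a \notin S -> exists k : mon n d -> F,
     g a = \sum_(s in S | (mweight W s < mweight W a)%N) (k s)%:P * g s) ->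
  exists b : mon n d, (2 ^ #|mon_supp b| <= #|S|)%N /\
    \sum_(a : mon n d) (\prod_i (f i ^+ (a i - b i) *+ 'C(a i, b i))) * g a != 0.
Proof.
move=> hf hq [a0 ha0] rel.
pose pi := 'X - al%:P; have pi0 : pi != 0 by rewrite polyXsubC_eq0.
(* The least order of vanishing v is divided out, so the values G_a(al) are the coefficients of the
   initial form, up to the units q^a. *)
have [|v [G [hG [a1 ha1]]]] := @factor_out_root F _ (fun a => pi ^+ mweight W a * g a) al.
  by exists a0; rewrite mulf_neq0 // expf_neq0.
pose qa (a : mon n d) := \prod_i q i ^+ a i.
have qa0 a : (qa a).[al] != 0.
  rewrite /qa horner_prod; apply/prodf_neq0 => i _.
  by rewrite horner_exp expf_neq0.
have fa (a : mon n d) : \prod_i f i ^+ a i = pi ^+ mweight W a * qa a.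
  rewrite /qa /mweight -prodrXr -big_split; apply: eq_bigr => i _ /=.
  by rewrite hf exprMn exprM.
(* Each lighter s contributes to G_a with a positive power of t - al. *)
have GS a : a \notin S -> (G a).[al] = 0.
  move=> aS; have [k hk] := rel a aS.
  have -> : G a = \sum_(s in S | (mweight W s < mweight W a)%N)
      (k s)%:P * (pi ^+ (mweight W a - mweight W s) * G s).
    apply: (mulfI (expf_neq0 v pi0)); rewrite -hG hk !mulr_sumr.
    apply: eq_bigr => s /andP[_ /ltnW le].
    transitivity ((k s)%:P * (pi ^+ (mweight W a - mweight W s) * (pi ^+ mweight W s * g s))).
      by rewrite [in LHS](_ : mweight W a = (mweight W a - mweight W s) + mweight W s)%N;
        [rewrite exprD; ring | rewrite subnK].
    by rewrite hG; ring.
  rewrite horner_sum big1 // => s /andP[_ lt].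
  by rewrite !hornerM horner_exp hornerXsubC subrr expr0n subn_eq0 leqNgt lt mul0r mulr0.
have [||b [hb sb]] := @sparse_shift_low_support F n d (fun a => (G a).[al] * (qa a).[al]) S.
- by exists a1; rewrite mulf_neq0.
- by move=> a /GS ->; rewrite mul0r.
exists b; split => //; apply: contraNneq sb => h0.
(* Multiplying by f^b completes f^(a - b) to f^a, so the sum becomes a binomial combination of the
   scaled coefficients; cancelling pi^v and evaluating at al leaves the sparse sum, which is
   nonzero. *)
have : (\prod_i f i ^+ b i) *
    (\sum_(a : mon n d) (\prod_i (f i ^+ (a i - b i) *+ 'C(a i, b i))) * g a) = 0 by rewrite h0 mulr0.
have -> : (\prod_i f i ^+ b i) *
    (\sum_(a : mon n d) (\prod_i (f i ^+ (a i - b i) *+ 'C(a i, b i))) * g a) =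
    pi ^+ v * \sum_(a : mon n d) (mon_bin a b)%:R * (qa a * G a).
  rewrite !mulr_sumr; apply: eq_bigr => a _.
  transitivity ((mon_bin a b)%:R * (\prod_i f i ^+ a i) * g a).
    rewrite mulrA; congr (_ * _).
    rewrite /mon_bin natr_prod -!big_split; apply: eq_bigr => i _ /=.
    have [le|lt] := leqP (b i) (a i); last by rewrite bin_small // mulr0n mulr0 mul0r.
    by rewrite mulrnAr -exprD subnKC // mulr_natl.
  rewrite fa; transitivity ((mon_bin a b)%:R * qa a * (pi ^+ mweight W a * g a)); first by ring.
  by rewrite hG; ring.
move/eqP; rewrite mulf_eq0 (negPf (expf_neq0 v pi0)) /= => /eqP/(congr1 (horner^~ al)).
rewrite /= horner0 horner_sum => e; apply/eqP; apply: etrans e; apply: eq_bigr => a _.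
by rewrite -polyC_natr !hornerM hornerC; ring.
Qed.

Lemma fraction_quotient (R : idomainType) (x : {fraction R}) :
  exists nu de : R, de != 0 /\ FracField.tofrac de * x = FracField.tofrac nu.
Proof.
elim/quotW: x => x; exists (\n_x), (\d_x); split; first exact: denom_ratioP.
rewrite -[LHS]/(FracField.mul _ _) !piE; apply/eqmodP.
rewrite /= FracField.equivfE /FracField.mulf !numden_Ratio ?(oner_eq0, mulf_neq0, denom_ratioP) //.
by rewrite mul1r mulr1 mulrC.
Qed.

Lemma common_denominator (R : idomainType) (T : finType) (v : T -> {fraction R}) :
  exists (D : R) (v' : T -> R),
    D != 0 /\ forall i, FracField.tofrac D * v i = FracField.tofrac (v' i).
Proof.
have h i : exists p : R * R,
    p.2 != 0 /\ FracField.tofrac p.2 * v i = FracField.tofrac p.1.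
  by have [nu [de hd]] := fraction_quotient (v i); exists (nu, de).
have [p hp] := fin_all_exists h.
exists (\prod_i (p i).2), (fun i => (\prod_(j | j != i) (p j).2) * (p i).1); split.
  by apply/prodf_neq0 => i _; case: (hp i).
move=> i; rewrite (bigD1 i) //= mulrC !rmorphM /= mulrA (mulrC (v i)).
by rewrite (hp i).2 mulrC.
Qed.

(** By contradiction: a coefficient outside the low-support span is detected by a functional that
    kills that span. Isolation relations have coefficients in F, so they survive applying it, and
    [shift_low_support] then yields a low-support coefficient that is not killed. *)
Lemma concentrated_of_isolating (F : fieldType) (n d w r c : nat)
    (A : 'M[{mpoly F[n]}]_(r, c)) (W : 'I_n -> nat) (al : F) (f : n.-tuple {poly F})
    (q : 'I_n -> {poly F}) (S : {set mon n d}) :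
  individual_degree_le d A ->
  (forall i, tnth f i = ('X - al%:P) ^+ W i * q i) -> (forall i, (q i).[al] != 0) ->
  (#|S| <= w ^ 2)%N ->
  (forall a, a \notin S -> exists k : mon n d -> F,
     mx_coeff A (mnm_of a) = \sum_(s in S | (mweight W s < mweight W a)%N)
       k s *: mx_coeff A (mnm_of s)) ->
  concentrated (roabp_threshold w) (shift f A).
Proof.
move=> hA hf hq cS rel a0.
pose K := {fraction {poly F}}; pose iota : {poly F} -> K := @FracField.tofrac {poly F}.
pose T b : 'M[K]_(r, c) := ft_coeff (shift f A) b.
(* Such supports are below the threshold, as 2^support <= w^2 < w^2 + 1. *)
pose Lw := [set b : mon n d | (2 ^ #|mon_supp b| <= w ^ 2)%N].
pose M : 'M[K]_(#|Lw|, r * c) := \matrix_i mxvec (T (mnm_of (enum_val i))).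
have [sub|nsub] := boolP (mxvec (T a0) <= M)%MS.
  have [D hD] := submxP sub.
  pose mon_of (m : 'X_{1..n}) : mon n d := [ffun i => inord (m i)].
  have mon_ofK b : mon_of (mnm_of b) = b.
    by apply/ffunP => i; rewrite ffunE mnmE inord_val.
  exists [seq mnm_of (enum_val i) | i <- enum 'I_#|Lw|].
  (* Coefficients must be indexed by multi-indices; for a listed m the sum has exactly one term. *)
  exists (fun m => \sum_(i | enum_val i == mon_of m) D 0 i); split.
    apply/allP => m /mapP[i _ ->]; rewrite mnm_supp_mnm_of.
    have := enum_valP i; rewrite inE => le.
    rewrite /roabp_threshold -(@ltn_exp2l 2) //; apply: leq_ltn_trans le _.
    by apply: leq_trans (up_logP _ _); rewrite // addn1.
  rewrite big_map big_enum /=.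
  apply: (can_inj mxvecK); rewrite hD -/(T _) mulmx_sum_row linear_sum /=.
  apply: eq_bigr => i _; rewrite rowK linearZ /= mon_ofK; congr (_ *: _).
  rewrite (big_pred1 i) // => j; rewrite /= (inj_eq enum_val_inj) //.
exfalso; move: nsub; rewrite submxE => /eqP/rowP nz.
have {nz} [j nz] : exists j, (mxvec (T a0) *m cokermx M) 0 j != 0.
  apply/existsP; apply: contra_notT nz => /existsPn h j.
  by rewrite [RHS]mxE; apply/eqP; have := h j; rewrite negbK.
(* Column j of the cokernel is the functional; after clearing denominators it takes values in
   polynomials, where evaluation at al makes sense. *)
have [D [lam [D0 hlam]]] := common_denominator (fun i => cokermx M i j).
pose L (v : 'M[K]_(r, c)) := (mxvec v *m cokermx M) 0 j.
pose g (a : mon n d) : {poly F} :=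
  \sum_i (mxvec (mx_coeff A (mnm_of a)) 0 i)%:P * lam i.
pose h (b : 'X_{1..n}) : {poly F} :=
  \sum_(a : mon n d) (\prod_i (tnth f i ^+ (a i - b i) *+ 'C(a i, b i))) * g a.
have entry b i : mxvec (mx_coeff (shift f A) b) 0 i =
    \sum_(a : mon n d) (\prod_i (tnth f i ^+ (a i - b i) *+ 'C(a i, b i))) *
      (mxvec (mx_coeff A (mnm_of a)) 0 i)%:P.
  rewrite (mx_coeff_shift f b hA) linear_sum /= summxE; apply: eq_bigr => a _.
  by rewrite linearZ /= mxE -(map_mxvec polyC) [in LHS]mxE.
have DL b : iota D * L (T b) = iota (h b).
  rewrite /L mxE mulr_sumr.
  transitivity (\sum_i iota (mxvec (mx_coeff (shift f A) b) 0 i * lam i)).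
    apply: eq_bigr => i _; rewrite mulrCA hlam /iota rmorphM; congr (_ * _).
    by rewrite -map_mxvec mxE.
  rewrite /iota -rmorph_sum; congr (FracField.tofrac _).
  under eq_bigr do rewrite entry mulr_suml.
  rewrite exchange_big; apply: eq_bigr => a _ /=.
  by rewrite mulr_sumr; apply: eq_bigr => i _; rewrite mulrA.
have iota0 p : (iota p == 0) = (p == 0) by exact: tofrac_eq0.
have [b [hb hb0]] : exists b : mon n d, (2 ^ #|mon_supp b| <= #|S|)%N /\
    \sum_(a : mon n d) (\prod_i (tnth f i ^+ (a i - b i) *+ 'C(a i, b i))) * g a != 0.
  apply: (shift_low_support hf hq).
    have hne : h a0 != 0.
      by rewrite -iota0 -DL mulf_eq0 negb_or iota0 D0; exact: nz.
    apply/existsP; apply: contraNT hne => /existsPn g0.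
    by rewrite /h big1 // => a _; have := g0 a; rewrite negbK => /eqP->; rewrite mulr0.
  move=> a /rel[k hk]; exists k; rewrite /g hk.
  under [RHS]eq_bigr do rewrite mulr_sumr.
  rewrite exchange_big; apply: eq_bigr => i _ /=.
  rewrite linear_sum summxE rmorph_sum mulr_suml; apply: eq_bigr => s _ /=.
  by rewrite linearZ mxE rmorphM mulrA.
have bL : b \in Lw by rewrite inE (leq_trans hb).
have Tb : (mxvec (T (mnm_of b)) <= M)%MS.
  have -> : mxvec (T (mnm_of b)) = row (enum_rank_in bL b) M.
    by rewrite rowK enum_rankK_in.
  exact: row_sub.
have : iota (h (mnm_of b)) = 0.
  by move: Tb; rewrite -DL /L submxE => /eqP->; rewrite mxE mulr0.
move/eqP; rewrite iota0; apply/negP; apply: contraNneq hb0 => e; apply/eqP; apply: etrans e.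
by apply: eq_bigr => a _; congr (_ * _); apply: eq_bigr => i _; rewrite mnmE.
Qed.

(** * Parameters and the shift *)

Definition base_size (n d w : nat) : nat := (n * d * w).+1.
(** The exponent leaves room for all moduli, and as a power of two it is reached by four
    squarings. *)
Definition radix (n d w : nat) : nat := (base_size n d w ^ 16)%N.
Definition digits (n : nat) : nat := (up_log 2 n).+1.
Definition num_weights (n d w : nat) : nat := (radix n d w ^ digits n)%N.
Definition weight (n d w j i : nat) : nat :=
  digit_weight (base_size n d w) (radix n d w) (digits n) j i.

Definition shift_poly (F : fieldType) (n d w : nat) (alpha : seq F) (i : nat) : {poly F} :=
  \prod_(j < num_weights n d w) ('X - (nth 0 alpha j)%:P) ^+ weight n d w j i.

(** Choose j isolating the order of A. The alphas are distinct, so all factors of f_i other than the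
    j-th are nonzero at alpha_j, and f_i vanishes there to order exactly W_j(i). *)
Lemma concentrated_shift_poly (F : fieldType) (n d w r c : nat) (alpha : seq F)
    (A : 'M[{mpoly F[n]}]_(r, c)) :
  (0 < n)%N -> (0 < d)%N -> (0 < w)%N -> (r <= w)%N -> (c <= w)%N ->
  uniq alpha -> (num_weights n d w <= size alpha)%N ->
  individual_degree_le d A -> computed_by_roabp w A ->
  concentrated (roabp_threshold w) (shift [tuple shift_poly n d w alpha i | i < n] A).
Proof.
move=> n0 d0 w0 rw cw ualpha salpha hA [pi hpi].
set v := [seq pi i | i <- enum 'I_n] in hpi.
have uv : uniq v by rewrite map_inj_uniq ?enum_uniq //; exact: perm_inj.
have sv : size v = n by rewrite size_map size_enum_ord.
have vi i : i \in v by rewrite -[i](permKV pi) map_f ?mem_enum.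
have [P [E [Q hE]]] := layered_product_coeff rw cw uv hpi.
set X := base_size n d w; set B := radix n d w.
have [nX dX wX ndX] : [/\ n < X, d < X, w < X & n * d < X]%N.
  have nd0 : (0 < n * d)%N by rewrite muln_gt0 n0.
  rewrite /X /base_size !ltnS leq_pmull // leq_pmulr //.
  by rewrite !(leq_trans _ (leq_pmulr (n * d) w0)) ?leq_pmulr ?leq_pmull.
have X2 : (2 <= X)%N by apply: leq_trans nX.
pose k := (X ^ 11)%N.
have k0 : (0 < k)%N by rewrite expn_gt0 (ltnW X2).
have kk : (k.*2.+1 <= X ^ 13)%N.
  have : (k * 4 <= k * X ^ 2)%N by rewrite leq_mul2l -[4%N]/(2 ^ 2)%N leq_sqr X2 orbT.
  rewrite /k -expnD -/k; change (11 + 2)%N with 13%N.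
  by move: k0; move: (X ^ 13)%N; move: k; lia.
have kX : (X * n * n * (maxn (w ^ 4) d.+1) ^ 2 <= k)%N.
  have h : (maxn (w ^ 4) d.+1 <= X ^ 4)%N.
    rewrite geq_max leq_exp2r // (ltnW wX) (leq_trans dX) //.
    by rewrite -[X in (X <= _)%N]expn1 leq_exp2l.
  rewrite /k (_ : X ^ 11 = X * X * X * (X ^ 4) ^ 2)%N; last by rewrite -expnM; ring.
  by rewrite leq_mul ?leq_sqr // leq_mul ?(ltnW nX) // leq_mul ?(ltnW nX).
have kB : (n * d * k.*2.+1 < B)%N.
  apply: (@leq_ltn_trans (X * X ^ 13)%N); first by rewrite leq_mul // ltnW.
  by rewrite -expnS ltn_exp2l.
have kB1 : (k.*2.+1 <= B)%N by apply: leq_trans kk _; rewrite leq_exp2l.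
have [j [hj [S [cS [_ hS]]]]] :=
  isolates_order E w0 k0 dX kX kB kB1 (l := up_log 2 n) uv sv (up_logP n (ltnSn 1)).
have fE i : tnth [tuple shift_poly n d w alpha i | i < n] i =
    ('X - (nth 0 alpha j)%:P) ^+ weight n d w j i *
    \prod_(l < num_weights n d w | l != j :> nat)
       ('X - (nth 0 alpha l)%:P) ^+ weight n d w l i.
  by rewrite tnth_mktuple /shift_poly (bigD1 (Ordinal hj)).
apply: (@concentrated_of_isolating _ _ d _ _ _ _ (weight n d w j) (nth 0 alpha j) _ _ S hA fE) => //.
  move=> i; rewrite horner_prod; apply/prodf_neq0 => l lj.
  rewrite horner_exp hornerXsubC expf_neq0 // subr_eq0 nth_uniq // 1?eq_sym //.
    exact: leq_trans salpha.
  exact: leq_trans salpha.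
move=> a aS.
have cE (b : mon n d) : mx_coeff A (mnm_of b) = P *m block_coeff E v b *m Q.
  rewrite hE; case: forallP => [_|[]]; last by move=> i; rewrite vi.
  by congr (_ *m _ *m _); apply: eq_bigr => i _; rewrite mnmE.
have sa : supported v a by apply/supportedP => i; rewrite vi.
have /memv_lincombP[x hx] := hS a sa aS.
exists x; rewrite cE hx mulmx_sumr mulmx_suml; apply: eq_bigr => s _.
by rewrite cE -scalemxAr -scalemxAl.
Qed.

(** * Programs *)

Local Open Scope nat_scope.

Section Programs.
Variable K : fieldType.
Implicit Types (p q : program) (st s : state K).

Definition runs p st st' (T : nat) : Prop := exists2 t, exec p st st' t & t <= T.

Lemma runs_le p st st' T T' : runs p st st' T -> T <= T' -> runs p st st' T'.
Proof. by case=> t h le le'; exists t => //; apply: leq_trans le'. Qed.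

Lemma runs_skip st : runs Skip st st 0.
Proof. by exists 0 => //; constructor. Qed.

Lemma runs_instr x st : runs (Instr x) st (exec_instr x st) 1.
Proof. by exists 1 => //; constructor. Qed.

Lemma runs_seq p q st1 st2 st3 T1 T2 :
  runs p st1 st2 T1 -> runs q st2 st3 T2 -> runs (Seq p q) st1 st3 (T1 + T2).
Proof.
by case=> t1 h1 le1 [t2 h2 le2]; exists (t1 + t2); [apply: exec_seq h1 h2 | apply: leq_add].
Qed.

Lemma runs_if_true b p q st st' T :
  eval_test b st -> runs p st st' T -> runs (If b p q) st st' T.+1.
Proof. by move=> e [t h le]; exists t.+1 => //; constructor; rewrite e. Qed.

Lemma runs_if_false b p q st st' T :
  ~~ eval_test b st -> runs q st st' T -> runs (If b p q) st st' T.+1.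
Proof. by move=> /negPf e [t h le]; exists t.+1 => //; constructor; rewrite e. Qed.

Definition block (l : seq instr) : program := foldr (fun x p => Seq (Instr x) p) Skip l.

Lemma runs_block l st :
  runs (block l) st (foldl (fun s x => exec_instr x s) st l) (size l).
Proof.
elim: l st => [|x l IH] st /=; first exact: runs_skip.
by rewrite -add1n; apply: runs_seq (runs_instr _ _) (IH _).
Qed.

(** Loops need a register holding 1, since addition has no immediate operand. *)
Definition rOne := 3.

Definition For (i m : nat) (body : program) : program :=
  Seq (Instr (NConst i 0)) (While (NLt i m) (Seq body (Instr (NAdd i i rOne)))).

(** Loop rule with an invariant indexed by completed rounds. A round costs the body, the increment
    and the test; the final 2 is the initialisation and the failing test. *)
Lemma runs_for (i m : nat) body (N T : nat) (I : nat -> state K -> Prop) st :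
  nmem st m = N -> i != m -> I 0 (nset st i 0) ->
  (forall k s, k < N -> I k s -> nmem s i = k ->
     exists s', [/\ runs body s s' T, nmem s' i = k, nmem s' rOne = 1, nmem s' m = N
                  & I k.+1 (nset s' i k.+1)]) ->
  exists s', [/\ runs (For i m body) st s' (N * (T + 2) + 2) & I N s'].
Proof.
move=> hm im I0 step.
suff loop k s : k <= N -> I (N - k) s -> nmem s i = N - k -> nmem s m = N ->
    exists s', runs (While (NLt i m) (Seq body (Instr (NAdd i i rOne)))) s s' (k * (T + 2) + 1)
      /\ I N s'.
  have [||||s' [h1 h2]] := loop N (nset st i 0); rewrite ?subnn //=.
  - by rewrite /upd eqxx.
  - by rewrite /upd eq_sym (negPf im).
  exists s'; split => //; apply: (runs_le (runs_seq (runs_instr (NConst i 0) _) h1)); lia.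
elim: k s => [|k IH] s kN Is si sm.
  exists s; split; last by move: Is; rewrite subn0.
  by exists 1 => //; constructor; rewrite /= si sm; lia.
have [|s' [[t h1 le1] si' s1 sm' I']] := step (N - k.+1) s _ Is si; first by lia.
have e : (N - k.+1).+1 = N - k by lia.
rewrite e in I'.
have [|||s'' [[t' h2 le2] I'']] := IH (nset s' i (N - k)) _ I'; rewrite ?(ltnW kN) //=.
- by rewrite /upd eqxx.
- by rewrite /upd eq_sym (negPf im).
exists s''; split => //; exists ((t + 1) + t').+1; last by lia.
apply: exec_while_step h2; first by rewrite /= si sm; lia.
apply: exec_seq h1 _.
have -> : nset s' i (N - k) = exec_instr (NAdd i i rOne) s' by rewrite /= si' s1 addn1 e.
by constructor.
Qed.

Definition frame (L : seq nat) st s : Prop := forall r, r \notin L -> nmem s r = nmem st r.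

Lemma frame_trans L L' st s s' :
  frame L st s -> frame L' s s' -> frame (L ++ L') st s'.
Proof.
by move=> h h' r; rewrite mem_cat negb_or => /andP[h1 h2]; rewrite h' // h.
Qed.

Lemma frame_sub L L' st s : frame L st s -> all (mem L') L -> frame L' st s.
Proof.
move=> h /allP sub r rL; apply: h; apply: contra rL => /sub.
by rewrite inE.
Qed.

End Programs.

Ltac frame_tac := let r := fresh "r" in
  move=> r; rewrite /= /upd !inE; repeat (case: (r == _); rewrite ?orbT //=).

Ltac frame_from h := let r := fresh "r" in
  move=> r; move: (h r); rewrite /= /upd !inE;
  repeat (case: (r == _); rewrite ?orbT //=); try exact: id.

(** * Arithmetic by counting loops *)

Section Arithmetic.
Variable K : fieldType.
Implicit Types (st s : state K).

Definition Mul (z x y i : nat) : program :=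
  Seq (Instr (NConst z 0)) (For i y (Instr (NAdd z z x))).

Lemma runs_mul z x y i st :
  uniq [:: z; x; y; i; rOne] -> nmem st rOne = 1 ->
  exists s, [/\ runs (Mul z x y i) st s (3 * nmem st y + 3),
    nmem s z = nmem st x * nmem st y, frame [:: z; i] st s & fmem s = fmem st].
Proof.
rewrite /= !inE !negb_or => /and5P[/and4P[zx zy zi zo] /and3P[xy xi xo] /andP[yi yo] io _] h1.
pose I k s := [/\ nmem s z = nmem st x * k, frame [:: z; i] st s & fmem s = fmem st].
have [||||s [hs [h2 h3 h4]]] := @runs_for K i y (Instr (NAdd z z x)) (nmem st y) 1 I (nset st z 0).
- by rewrite /= /upd eq_sym (negPf zy).
- by rewrite eq_sym.
- split => //=; first by rewrite /upd (negPf zi) eqxx muln0.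
  by move=> r; rewrite !inE negb_or /= /upd => /andP[/negPf-> /negPf->].
- move=> k s kN [e1 e2 e3] si; eexists; split; first exact: runs_instr.
  + by rewrite /= /upd eq_sym (negPf zi).
  + by rewrite /= /upd eq_sym (negPf zo) e2 // !inE negb_or eq_sym zo eq_sym io.
  + by rewrite /= /upd eq_sym (negPf zy) e2 // !inE negb_or eq_sym zy yi.
  split => //=.
    rewrite /upd (negPf zi) eqxx e1 e2 ?mulnS 1?addnC //.
    by rewrite !inE negb_or eq_sym zx xi.
  by move=> r hr; have := e2 r hr; move: hr; rewrite !inE negb_or /= /upd => /andP[/negPf-> /negPf->].
exists s; split => //; apply: (runs_le (runs_seq (runs_instr (NConst z 0) _) hs)); lia.
Qed.

Definition rN := 0.
Definition rX := 4.
Definition rB := 5.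
Definition rLev := 6.
Definition rZ := 7.
Definition rT := 8.
Definition rC := 9.
Definition rI := 14.
Definition rJ := 15.
Definition rAcc := 16.
Definition rScale := 17.
Definition rJJ := 18.
Definition rQ := 20.
Definition rR := 21.
Definition rM := 22.
Definition rP := 23.
Definition rS := 25.

Lemma divmodS k B : 0 < B ->
  k.+1 %/ B = (if k %% B + 1 < B then k %/ B else k %/ B + 1) /\
  k.+1 %% B = (if k %% B + 1 < B then k %% B + 1 else 0).
Proof.
move=> B0; have lt := ltn_pmod k B0.
have e : k.+1 = k %/ B * B + (k %% B + 1) by rewrite addnA -divn_eq addn1.
rewrite e divnMDl // modnMDl; case: ifP => [h|h].
  by rewrite (divn_small h) (modn_small h) addn0.
by rewrite (_ : k %% B + 1 = B) ?divnn ?modnn ?B0 //; lia.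
Qed.

(** Counts up to the dividend while carrying quotient and remainder along, as in [divmodS]. *)
Definition DivMod : program :=
  Seq (block [:: NConst rQ 0; NConst rR 0])
      (For 13 rJJ (Seq (Instr (NAdd rR rR rOne))
        (If (NLt rR rB) Skip (block [:: NConst rR 0; NAdd rQ rQ rOne])))).

Lemma runs_divmod st : nmem st rOne = 1 -> 0 < nmem st rB ->
  exists s, [/\ runs DivMod st s (6 * nmem st rJJ + 4),
    nmem s rQ = nmem st rJJ %/ nmem st rB, nmem s rR = nmem st rJJ %% nmem st rB,
    frame [:: 13; rQ; rR] st s & fmem s = fmem st].
Proof.
move=> h1 B0; set J := nmem st rJJ; set B := nmem st rB in B0 *.
pose I k s := [/\ nmem s rQ = k %/ B, nmem s rR = k %% B,
  frame [:: 13; rQ; rR] st s & fmem s = fmem st].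
have [||||s [hs [e1 e2 e3 e4]]] := @runs_for K 13 rJJ (Seq (Instr (NAdd rR rR rOne))
  (If (NLt rR rB) Skip (block [:: NConst rR 0; NAdd rQ rQ rOne]))) J 4 I
  (foldl (fun s x => exec_instr x s) st [:: NConst rQ 0; NConst rR 0]) => //.
- split => //=; rewrite ?div0n ?mod0n //; frame_tac.
- move=> k s kN [e1 e2 e3 e4] si.
  have eB : nmem s rB = B by rewrite e3.
  have e1' : nmem s rOne = 1 by rewrite e3.
  have eJ : nmem s rJJ = J by rewrite e3.
  have [q1 r1] := divmodS k B0.
  have [ltB|geB] := boolP (k %% B + 1 < B).
    rewrite ltB in q1 r1; eexists; split.
    + apply: (runs_le (T := 2) (T' := 4) _ isT).
      apply: (runs_seq (T1 := 1) (T2 := 1) (runs_instr _ _)).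
      by apply: runs_if_true (runs_skip _); rewrite /= /upd /= e2 e1' eB.
    + exact: si. + exact: e1'. + exact: eJ.
    split => //=; rewrite ?q1 ?r1 /upd //= ?e2 ?e1' //.
    by frame_from e3.
  rewrite (negPf geB) in q1 r1; eexists; split.
  + apply: (runs_seq (T2 := 3) (runs_instr _ _)).
    by apply: runs_if_false (runs_block _ _); rewrite /= /upd /= e2 e1' eB.
  + exact: si. + exact: e1'. + exact: eJ.
  split => //=; rewrite ?q1 ?r1 /upd //= ?e1 ?e1' //.
  by frame_from e3.
exists s; split => //.
by apply: (runs_le (runs_seq (runs_block _ _) hs)); rewrite /=; lia.
Qed.

(** Each multiplication by X is X modular additions. Both summands are below M, so one conditional
    subtraction reduces their sum. The start value 1 mod M is 0 when M = 1. *)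
Definition PowMod : program :=
  Seq (If (NLt rOne rM) (Instr (NConst rP 1)) (Instr (NConst rP 0)))
      (For 24 rI (Seq (Instr (NConst rS 0))
        (Seq (For 26 rX (Seq (Instr (NAdd rS rS rP))
                             (If (NLt rS rM) Skip (Instr (NSub rS rS rM)))))
             (Instr (NMove rP rS))))).

Lemma runs_mulmod st : nmem st rOne = 1 -> nmem st rP < nmem st rM -> nmem st rS = 0 ->
  exists s, [/\ runs (For 26 rX (Seq (Instr (NAdd rS rS rP))
      (If (NLt rS rM) Skip (Instr (NSub rS rS rM))))) st s (5 * nmem st rX + 2),
    nmem s rS = (nmem st rX * nmem st rP) %% nmem st rM, 
    frame [:: 26; rS] st s & fmem s = fmem st].
Proof.
move=> h1; set P := nmem st rP; set M := nmem st rM; set X := nmem st rX => PM S0.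
pose I k s := [/\ nmem s rS = (k * P) %% M, frame [:: 26; rS] st s & fmem s = fmem st].
have [||||s [hs [e1 e2 e3]]] := @runs_for K 26 rX (Seq (Instr (NAdd rS rS rP))
      (If (NLt rS rM) Skip (Instr (NSub rS rS rM)))) X 3 I st => //.
- by split => //=; [rewrite mod0n | frame_tac].
- move=> k s kN [e1 e2 e3] si.
  have e1' : nmem s rOne = 1 by rewrite e2.
  have eX : nmem s rX = X by rewrite e2.
  have eP : nmem s rP = P by rewrite e2.
  have eM : nmem s rM = M by rewrite e2.
  have lt := ltn_pmod (k * P) (leq_ltn_trans (leq0n P) PM).
  have mE : (k.+1 * P) %% M = ((k * P) %% M + P) %% M by rewrite modnDml mulSn addnC.
  have [ltM|geM] := boolP ((k * P) %% M + P < M).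
    eexists; split.
    + apply: (runs_le (T := 2) (T' := 3) _ isT).
      apply: (runs_seq (T1 := 1) (T2 := 1) (runs_instr _ _)).
      by apply: runs_if_true (runs_skip _); rewrite /= /upd /= e1 eP eM.
    + exact: si. + exact: e1'. + exact: eX.
    split => //=; rewrite ?mE ?(modn_small ltM) /upd //= ?e1 ?eP //.
    by frame_from e2.
  eexists; split.
  + apply: (runs_seq (T2 := 2) (runs_instr _ _)).
    by apply: runs_if_false (runs_instr _ _); rewrite /= /upd /= e1 eP eM.
  + exact: si. + exact: e1'. + exact: eX.
  split => //=.
    rewrite mE /upd /= e1 eP eM.
    have {2}-> : (k * P) %% M + P = (k * P) %% M + P - M + M by rewrite subnK // leqNgt.
    have h : (k * P) %% M + P - M < M by move: lt PM; lia.
    by rewrite modnDr (modn_small h).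
  by frame_from e2.
exists s; split => //; apply: (runs_le hs); lia.
Qed.

Lemma runs_powmod st : nmem st rOne = 1 -> 0 < nmem st rM ->
  exists s, [/\ runs PowMod st s (nmem st rI * (5 * nmem st rX + 6) + 4),
    nmem s rP = nmem st rX ^ nmem st rI %% nmem st rM, 
    frame [:: 24; 26; rS; rP] st s & fmem s = fmem st].
Proof.
move=> h1; set M := nmem st rM; set X := nmem st rX; set i := nmem st rI => M0.
pose I k s := [/\ nmem s rP = X ^ k %% M, frame [:: 24; 26; rS; rP] st s & fmem s = fmem st].
pose s0 := nset st rP (1 %% M).
have h0 : runs (If (NLt rOne rM) (Instr (NConst rP 1)) (Instr (NConst rP 0))) st s0 2.
  have [lt|ge] := ltnP 1 M.
    by rewrite /s0 modn_small //; apply: runs_if_true (runs_instr _ _); rewrite /= h1.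
  rewrite /s0 (_ : M = 1); last by lia.
  by apply: runs_if_false (runs_instr _ _); rewrite /= h1 -/M; lia.
have [||||s [hs [e1 e2 e3]]] := @runs_for K 24 rI (Seq (Instr (NConst rS 0))
        (Seq (For 26 rX (Seq (Instr (NAdd rS rS rP))
                             (If (NLt rS rM) Skip (Instr (NSub rS rS rM)))))
             (Instr (NMove rP rS)))) i (5 * X + 4) I s0 => //.
- by split => //=; frame_tac.
- move=> k s kN [e1 e2 e3] si.
  have [|||s1 [r1 v1 f1 g1]] := @runs_mulmod (nset s rS 0).
  + by rewrite /= /upd /= e2.
  + by rewrite /= /upd /= e1 e2 // ltn_pmod.
  + by [].
  have f2 : frame [:: rS; 26; rS] s s1.
    apply: (@frame_trans _ [:: rS] [:: 26; rS] _ (nset s rS 0)) => //.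
    by frame_tac.
  eexists; split.
  + apply: (runs_le (runs_seq (runs_instr (NConst rS 0) _)
      (runs_seq r1 (runs_instr (NMove rP rS) _)))).
    by rewrite /= /upd /= e2 // -/X; lia.
  + by rewrite /= /upd /= f2.
  + by rewrite /= /upd /= f2 // e2.
  + by rewrite /= /upd /= f2 // e2.
  split => //=; last by rewrite g1.
    rewrite /upd /= v1 /= /upd /= e1 !e2 // modnMmr expnS //.
  have f3 : frame [:: 24; rP] s1 (nset (nset s1 rP (nmem s1 rS)) 24 k.+1) by frame_tac.
  by apply: (frame_sub (frame_trans e2 (frame_trans f2 f3))).
by exists s; split => //; apply: (runs_le (runs_seq h0 hs)); lia.
Qed.
End Arithmetic.

(** * Computing a weight digit by digit *)

Definition WeightStep : program :=
  Seq DivMod (Seq (Instr (NAdd rM rR rOne)) (Seq PowMod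
    (Seq (Mul rT rScale rP rC) (Seq (Instr (NAdd rAcc rAcc rT))
      (Seq (Mul rT rScale rB rC) (block [:: NMove rScale rT; NMove rJJ rQ])))))).

Definition Weight : program :=
  Seq (block [:: NConst rAcc 0; NConst rScale 1; NMove rJJ rJ]) (For 19 rLev WeightStep).

Definition weight_regs : seq nat :=
  [:: 13; 19; 24; 26; rQ; rR; rS; rP; rT; rC; rAcc; rScale; rJJ; rM].

Section WeightProgram.
Variable K : fieldType.
Implicit Types (st s : state K).

Lemma runs_weight st : nmem st rOne = 1 -> 0 < nmem st rB ->
  let: (X, B, i, j, lev) := (nmem st rX, nmem st rB, nmem st rI, nmem st rJ, nmem st rLev) in
  exists s, [/\ runs Weight st s (lev * (6 * j + i * (5 * X + 6) + 6 * B + 21) + 5),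
    nmem s rAcc = digit_weight X B lev j i,
    frame weight_regs st s & fmem s = fmem st].
Proof.
move=> h1; set B := nmem st rB; set X := nmem st rX; set i := nmem st rI.
set j := nmem st rJ; set lev := nmem st rLev => B0.
pose I l s := [/\ nmem s rAcc = digit_weight X B l j i, nmem s rScale = B ^ l,
  nmem s rJJ = j %/ B ^ l, frame weight_regs st s & fmem s = fmem st].
pose s0 : state K := foldl (fun s x => exec_instr x s) st
  [:: NConst rAcc 0; NConst rScale 1; NMove rJJ rJ].
have [||||s [hs [e1 e2 e3 e4 e5]]] := @runs_for K 19 rLev WeightStep lev
  (6 * j + i * (5 * X + 6) + 6 * B + 19) I s0 => //.
- split => //=; rewrite ?divn1 //; last by frame_tac.
  by rewrite /digit_weight big_ord0.
- move=> l s lN [e1 e2 e3 e4 e5] si.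
  have s1 : nmem s rOne = 1 by rewrite e4.
  have sB : nmem s rB = B by rewrite e4.
  have [||sa [ra qa da fa ga]] := @runs_divmod K s; rewrite ?sB //.
  rewrite sB e3 in qa da.
  pose sb := nset sa rM (nmem sa rR + nmem sa rOne).
  have rb : runs (Instr (NAdd rM rR rOne)) sa sb 1 by apply: runs_instr.
  have fb : frame [:: rM] sa sb by frame_tac.
  have fab := frame_trans fa fb.
  have mb : nmem sb rM = ((j %/ B ^ l) %% B).+1.
    by rewrite /= /upd /= da fa // s1 addn1.
  have [||sc [rc pc fc gc]] := @runs_powmod K sb.
  + by rewrite fab.
  + by rewrite mb.
  have fabc := frame_trans fab fc.
  rewrite mb !fab // !e4 // -/X -/i in pc rc.
  have [||sd [rd td fd gd]] := @runs_mul K rT rScale rP rC sc; rewrite ?fabc //.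
  have fabcd := frame_trans fabc fd.
  rewrite pc fabc // e2 in td rd.
  pose se := nset sd rAcc (nmem sd rAcc + nmem sd rT).
  have re : runs (Instr (NAdd rAcc rAcc rT)) sd se 1 by apply: runs_instr.
  have fe : frame [:: rAcc] sd se by frame_tac.
  have fabcde := frame_trans fabcd fe.
  have [||sf [rf tf ff gf]] := @runs_mul K rT rScale rB rC se; rewrite ?fabcde //.
  have fall := frame_trans fabcde ff.
  rewrite !fabcde // sB e2 in tf rf.
  pose sg : state K := foldl (fun s x => exec_instr x s) sf [:: NMove rScale rT; NMove rJJ rQ].
  have rg : runs (block [:: NMove rScale rT; NMove rJJ rQ]) sf sg 2 by apply: runs_block.
  have pB : X ^ i %% ((j %/ B ^ l) %% B).+1 <= B.
    apply: leq_trans (ltnW (ltn_pmod _ _)) _; rewrite ?ltn_pmod //.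
  have jB : j %/ B ^ l <= j by apply: leq_div.
  exists sg; split.
  + apply: (runs_le (runs_seq ra (runs_seq rb (runs_seq rc (runs_seq rd
      (runs_seq re (runs_seq rf rg))))))).
    rewrite e3; move: pB jB; lia.
  + by rewrite /= /upd /= fall.
  + by rewrite /= /upd /= fall.
  + by rewrite /= /upd /= fall // e4.
  have fcc := frame_trans fc (frame_trans fd (frame_trans fe ff)).
  split => //=.
  + rewrite /upd /= ff // /upd /= fabcd // td e1.
    by rewrite /digit_weight big_ord_recr.
  + by rewrite /upd /= tf expnSr.
  + by rewrite /upd /= fcc // fb // qa expnSr divnMA.
  + have fg : frame [:: rScale; rJJ; 19] sf (nset sg 19 l.+1) by frame_tac.
    by apply: (frame_sub (frame_trans e4 (frame_trans fall fg))).
  + by rewrite gf /= gd gc /= ga.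
exists s; split => //.
by apply: (runs_le (runs_seq (runs_block _ _) hs)); rewrite /=; lia.
Qed.
End WeightProgram.

(** * Multiplying coefficient rows by linear factors *)

Definition rBase := 12.
Definition rOff := 27.
Definition rAl := 28.
Definition rTmp := 32.
Definition rCur := 33.
Definition rPrev := 34.
Definition rLen := 11.

(** In-place update c_k := c_(k-1) - alpha * c_k from low to high degree; [rPrev] points to the
    saved old value of c_(k-1). Coefficients past the row are dropped, which cannot affect lower
    ones. *)
Definition MulLinear : program :=
  Seq (Instr (FZero rPrev))
      (For 30 rLen (block [:: NAdd 31 rOff 30; FMul rTmp 31 rAl; FMove rCur 31;
                             FSub 31 rPrev rTmp; FMove rPrev rCur])).

Section FieldMemory.
Variable K : fieldType.
Implicit Types (st s : state K).

Definition fframe (P : pred nat) st s : Prop := forall a, ~~ P a -> fmem s a = fmem st a.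

Definition scratch st : pred nat := fun a => a \in [:: nmem st rTmp; nmem st rCur; nmem st rPrev].

Definition in_row st : pred nat := fun a => nmem st rOff <= a < nmem st rOff + nmem st rLen.

(** The chain of inequalities keeps the row, the current alpha and the three scratch cells pairwise
    disjoint. *)
Definition layout_ok st : bool :=
  [&& nmem st rOff + nmem st rLen <= nmem st rAl, nmem st rAl < nmem st rTmp,
      nmem st rTmp < nmem st rCur & nmem st rCur < nmem st rPrev].

Definition row_is st (p : {poly K}) : Prop :=
  forall k, k < nmem st rLen -> fmem st (nmem st rOff + k) = (p`_k)%R.

Lemma runs_mul_linear st (p : {poly K}) :
  nmem st rOne = 1 -> layout_ok st -> row_is st p ->
  exists s, [/\ runs MulLinear st s (7 * nmem st rLen + 3),
    frame [:: 30; 31] st s,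
    row_is s (p * ('X - (fmem st (nmem st rAl))%:P))%R &
    fframe (predU (scratch st) (in_row st)) st s].
Proof.
move=> h1 /and4P[]; set off := nmem st rOff; set len := nmem st rLen.
set al := nmem st rAl; set tp := nmem st rTmp; set cu := nmem st rCur; set pr := nmem st rPrev.
move=> ok1 ok2 ok3 ok4 hp; set alpha := fmem st al.
pose I k s := [/\ frame [:: 30; 31] st s,
  forall x, x < len -> fmem s (off + x) = (if (x < k)%N then (p * ('X - alpha%:P))`_x else p`_x)%R,
  fmem s pr = ((p * 'X)`_k)%R & fframe (predU (scratch st) (in_row st)) st s].
have [||||s [hs [e1 e2 e3 e4]]] := @runs_for K 30 rLen
  (block [:: NAdd 31 rOff 30; FMul rTmp 31 rAl; FMove rCur 31; FSub 31 rPrev rTmp; FMove rPrev rCur])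
  len 5 I (fset st rPrev 0%R) => //.
- split => //=; first by frame_tac.
  + move=> x xl; rewrite /upd -/pr (_ : (off + x == pr) = false) ?hp //.
    by move: ok1 ok2 ok3 ok4 xl; lia.
  + by rewrite /upd eqxx coefMX.
  + move=> a /=; rewrite /upd /scratch !inE !negb_or -!andbA => /and4P[_ _ /negPf ap _].
    by rewrite ap.
- move=> k s kN [e1 e2 e3 e4] si.
  pose s' : state K := foldl (fun s x => exec_instr x s) s [:: NAdd 31 rOff 30;
    FMul rTmp 31 rAl; FMove rCur 31; FSub 31 rPrev rTmp; FMove rPrev rCur].
  have m' : nmem s' = upd (nmem s) 31 (off + k) by rewrite /= si e1.
  have sal : fmem s al = alpha.
    by apply: e4; rewrite /= /scratch /in_row !inE -/al -/tp -/cu -/pr -/off -/len; lia.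
  have sc : fmem s (off + k) = (p`_k)%R by rewrite e2 // ltnn.
  have f' a : fmem s' a = (if a == pr then p`_k
      else if a == (off + k)%N then (p * ('X - alpha%:P))`_k
      else if a == cu then p`_k else if a == tp then p`_k * alpha else fmem s a)%R.
    rewrite /= /fget /= /upd /= si !e1 // -/off -/tp -/cu -/pr -/al eqxx.
    have [n1 n2 n3 n4] : [/\ (cu == off + k) = false, (pr == cu) = false, (pr == tp) = false &
       (tp == cu) = false] by split; lia.
    have [n5 n6] : (off + k == tp) = false /\ (off + k == cu) = false by split; lia.
    rewrite !eqxx n1 n2 n3 n4 n5 sc sal e3.
    by rewrite mulrBr coefB coefMC.
  exists s'; split; first exact: runs_block.
  + by rewrite m' /upd /=.
  + by rewrite m' /upd /= e1.
  + by rewrite m' /upd /= e1.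
  split.
  + by rewrite /frame -[nmem (nset s' _ _)]/(upd (nmem s') 30 k.+1) m'; frame_from e1.
  + move=> x xl; rewrite -[fmem (nset s' _ _)]/(fmem s') f' eqn_add2l.
    rewrite (_ : (off + x == pr) = false); last by lia.
    rewrite (_ : (off + x == cu) = false); last by lia.
    rewrite (_ : (off + x == tp) = false); last by lia.
    by rewrite ltnS leq_eqVlt; case: eqP => [->|] //= _; rewrite e2.
  + by rewrite -[fmem (nset s' _ _)]/(fmem s') f' eqxx coefMX.
  + move=> a; rewrite -[fmem (nset s' _ _)]/(fmem s') f' => na; rewrite -e4 //.
    move: na; rewrite /= /scratch /in_row !inE -/tp -/cu -/pr -/off -/len !negb_or.
    case/andP=> /and3P[/negPf-> /negPf-> /negPf->] na.
    by rewrite (_ : (a == off + k) = false) //; lia.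
exists s; split => //.
- by apply: (runs_le (runs_seq (runs_instr (FZero rPrev) _) hs)); lia.
- by move=> x; rewrite !e1 // -/len => xl; rewrite e2 // xl.
Qed.
End FieldMemory.

Section MulPower.
Variable K : fieldType.
Implicit Types (st s : state K).

Lemma runs_mul_power st (p : {poly K}) :
  nmem st rOne = 1 -> layout_ok st -> row_is st p ->
  exists s, [/\ runs (For 29 rAcc MulLinear) st s (nmem st rAcc * (7 * nmem st rLen + 5) + 2),
    frame [:: 29; 30; 31] st s,
    row_is s (p * ('X - (fmem st (nmem st rAl))%:P) ^+ nmem st rAcc)%R &
    fframe (predU (scratch st) (in_row st)) st s].
Proof.
move=> h1 ok hp; set al := fmem st (nmem st rAl).
pose I k s := [/\ frame [:: 29; 30; 31] st s, row_is s (p * ('X - al%:P) ^+ k)%R &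
  fframe (predU (scratch st) (in_row st)) st s].
have [||||s [hs [e1 e2 e3]]] := @runs_for K 29 rAcc MulLinear (nmem st rAcc)
  (7 * nmem st rLen + 3) I st => //.
- split => //; first by frame_tac.
  by move=> x xl; rewrite expr0 mulr1; apply: hp.
- move=> k s kN [e1 e2 e3] si.
  have s1 : nmem s rOne = 1 by rewrite e1.
  have oks : layout_ok s by rewrite /layout_ok !e1.
  have [s' [hs' f' r' g']] := runs_mul_linear s1 oks e2.
  have sal : fmem s (nmem s rAl) = al.
    rewrite e1 // e3 //= /scratch /in_row !inE.
    by move: ok => /and4P[]; lia.
  rewrite sal -mulrA -exprSr in r'.
  exists s'; split.
  + by move: hs'; rewrite e1.
  + by rewrite f'.
  + by rewrite f'.
  + by rewrite f' // e1.
  split.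
  + have f2 : frame [:: 29] s' (nset s' 29 k.+1) by frame_tac.
    by apply: (frame_sub (frame_trans e1 (frame_trans f' f2))).
  + exact: r'.
  + move=> a na; rewrite /= g' ?e3 //.
    by move: na; rewrite /= /scratch /in_row !e1.
exists s; split => //; apply: (runs_le hs); lia.
Qed.
End MulPower.

Definition RowStep : program :=
  Seq Weight (Seq (Instr (NAdd rAl rBase rJ)) (For 29 rAcc MulLinear)).

Definition Rows : program :=
  For rI rN (Seq (Instr (FOne rOff))
    (Seq (For rJ rZ RowStep) (Instr (NAdd rOff rOff rLen)))).

(* Field memory: f_i fills the Len cells from i * Len on; behind the n rows come *)
(* a copy of the alpha_j (the input is overwritten by the rows) and three scratch *)
(* cells.                                                                        *)
Definition const_regs : seq nat :=
  [:: rOne; rN; rX; rB; rLev; rZ; rLen; rBase; rTmp; rCur; rPrev].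

Definition row_regs : seq nat := rJ :: rAl :: 29 :: 30 :: 31 :: weight_regs.

Section MainLoop.
Variable K : fieldType.
Variables (n X B lev Z Len : nat) (alpha : nat -> K).
Hypotheses (B0 : 0 < B) (ZE : Z = B ^ lev) (Len0 : 0 < Len).
Implicit Types (st s : state K).

Definition consts s : Prop := [seq nmem s r | r <- const_regs] =
  [:: 1; n; X; B; lev; Z; Len; n * Len; n * Len + Z; n * Len + Z + 1; n * Len + Z + 2].

Lemma consts_frame L s s' :
  frame L s s' -> all (fun r => r \notin L) const_regs -> consts s -> consts s'.
Proof.
by rewrite /consts => f /allP h <-; apply/eq_in_map => r /h; apply: f.
Qed.

Definition alphas_at s : Prop := forall j, j < Z -> fmem s (n * Len + j) = alpha j.

Definition row_poly (i j : nat) : {poly K} :=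
  (\prod_(l < j) ('X - (alpha l)%:P) ^+ digit_weight X B lev l i)%R.

Definition row_time : nat :=
  lev * (6 * Z + n * (5 * X + 6) + 6 * B + 21) + Z * (7 * Len + 5) + 8.

Lemma runs_row st :
  consts st -> alphas_at st -> nmem st rI < n -> nmem st rOff + Len <= n * Len ->
  row_is st 1%R ->
  exists s, [/\ runs (For rJ rZ RowStep) st s (Z * (row_time + 2) + 2),
    frame row_regs st s, row_is s (row_poly (nmem st rI) Z) &
    fframe (predU (fun a => n * Len + Z <= a) (in_row st)) st s].
Proof.
move=> C al; set i := nmem st rI; set off := nmem st rOff => iN offN r1.
have [c1 cN cX cB cl cZ cL cb ct cc cp] := C.
pose P := predU (fun a => n * Len + Z <= a) (in_row st).
pose I k s := [/\ frame row_regs st s, row_is s (row_poly i k) & fframe P st s].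
have [||||s [hs [e1 e2 e3]]] := @runs_for K rJ rZ RowStep Z row_time I st => //.
- split => //; first by frame_tac.
  by rewrite /row_poly big_ord0.
- move=> j s jZ [e1 e2 e3] sj.
  have [d1 dN dX dB dl dZ dL db dt dc dp] := consts_frame e1 isT C.
  have [||sa [ra wa fa ga]] := @runs_weight K s; rewrite ?dB //.
  have si : nmem s rI = i by rewrite e1.
  rewrite dX dB sj dl si in ra wa.
  have [sb [rb fb ab gb]] : exists sb, [/\ runs (Instr (NAdd rAl rBase rJ)) sa sb 1,
      frame [:: rAl] sa sb, nmem sb rAl = nmem sa rBase + nmem sa rJ & fmem sb = fmem sa].
    by eexists; split; first exact: runs_instr; first by frame_tac.
  have fab := frame_trans fa fb.
  rewrite !fa // db sj in ab.
  have [u1 uN uX uB ul uZ uL ub ut uc up] := consts_frame fab isT (consts_frame e1 isT C).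
  have offb : nmem sb rOff = off by rewrite fab // e1.
  have okb : layout_ok sb.
    by rewrite /layout_ok offb ab uL ut uc up; apply/and4P; split; lia.
  have rowb : row_is sb (row_poly i j).
    by move=> k; rewrite offb uL gb ga -(e1 rOff isT : _ = off) => kL; apply: e2; rewrite dL.
  have [sc [rc fc rowc gc]] := runs_mul_power u1 okb rowb.
  have accb : nmem sb rAcc = digit_weight X B lev j i by rewrite fb.
  have alb : fmem sb (nmem sb rAl) = alpha j.
    rewrite ab gb ga e3 ?al //= /in_row -/off cL; lia.
  rewrite accb uL in rc; rewrite accb alb in rowc.
  have wlt : digit_weight X B lev j i < Z by rewrite ZE digit_weight_lt.
  have fabc := frame_trans fab fc.
  exists sc; split.
  + apply: (runs_le (runs_seq ra (runs_seq rb rc))).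
    rewrite /row_time.
    have h1 : lev * (6 * j + i * (5 * X + 6) + 6 * B + 21) <=
              lev * (6 * Z + n * (5 * X + 6) + 6 * B + 21).
      rewrite leq_mul2l; apply/orP; right.
      have : i * (5 * X + 6) <= n * (5 * X + 6) by rewrite leq_mul2r (ltnW iN) orbT.
      lia.
    have h2 : digit_weight X B lev j i * (7 * Len + 5) <= Z * (7 * Len + 5).
      by rewrite leq_mul2r (ltnW wlt) orbT.
    by move: h1 h2; lia.
  + by rewrite fabc.
  + by rewrite fabc.
  + by rewrite fabc.
  split.
  + have fj : frame [:: rJ] sc (nset sc rJ j.+1) by frame_tac.
    by apply: (frame_sub (frame_trans e1 (frame_trans fabc fj))).
  + by rewrite /row_poly big_ord_recr; apply: rowc.
  + move=> a na; rewrite /= gc /= ?gb ?ga ?e3 //.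
    move: na; rewrite /P /= /scratch /in_row !inE offb uL ut uc up -/off cL; lia.
exists s; split => //; apply: (runs_le hs); lia.
Qed.

Lemma runs_rows st :
  consts st -> alphas_at st -> nmem st rOff = 0 ->
  (forall a, a < n * Len -> fmem st a = 0%R) ->
  exists s, [/\ runs Rows st s (n * (Z * (row_time + 2) + 6) + 2), consts s &
    forall i k, i < n -> k < Len -> fmem s (i * Len + k) = ((row_poly i Z)`_k)%R].
Proof.
move=> C al off0 zero.
have [c1 cN cX cB cl cZ cL cb ct cc cp] := C.
pose L := [:: rI, rOff & row_regs].
pose I i s := [/\ frame L st s, nmem s rOff = i * Len, alphas_at s &
  forall i' k, i' < n -> k < Len ->
    fmem s (i' * Len + k) = (if (i' < i)%N then (row_poly i' Z)`_k else 0)%R].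
have rowN i k : i < n -> k < Len -> i * Len + k < n * Len.
  move=> iN kL; have : i.+1 * Len <= n * Len by rewrite leq_mul2r iN orbT.
  by rewrite mulSn; lia.
have [|||s [hs [e1 e2 e3 e4]]] := @runs_for K rI rN
  (Seq (Instr (FOne rOff)) (Seq (For rJ rZ RowStep) (Instr (NAdd rOff rOff rLen)))) n (Z * (row_time + 2) + 4) I st cN => //.
- split => //=; first by frame_tac.
  by move=> i k iN kL; rewrite zero ?rowN.
- move=> i s iN [e1 e2 e3 e4] si.
  pose sa := fset s rOff 1%R.
  have ra : runs (Instr (FOne rOff)) s sa 1 by apply: runs_instr.
  have ga a : fmem sa a = (if a == i * Len then 1 else fmem s a)%R by rewrite /= /upd e2.
  have Ca : consts sa by apply: (consts_frame e1 isT C).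
  have [d1 dN dX dB dl dZ dL db dt dc dp] := Ca.
  have iN' : i.+1 * Len <= n * Len by rewrite leq_mul2r iN orbT.
  rewrite mulSn in iN'.
  have [||||sb [rb fb rowb gb]] := @runs_row sa Ca.
  + move=> j jZ; rewrite ga (_ : (_ == _) = false) ?e3 //.
    by lia.
  + by rewrite /= si.
  + by rewrite /= e2 addnC.
  + move=> k; rewrite dL [nmem sa rOff]e2 ga -[X in _ == X]addn0 eqn_add2l coef1 => kL.
    by case: eqP => //= _; rewrite e4 // ltnn.
  rewrite /= si in rowb.
  have bOff : nmem sb rOff = i * Len by rewrite fb.
  have Cb : consts sb by apply: (consts_frame fb isT Ca).
  have [u1 uN uX uB ul uZ uL ub ut uc up] := Cb.
  pose sc := nset sb rOff (nmem sb rOff + nmem sb rLen).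
  have rc : runs (Instr (NAdd rOff rOff rLen)) sb sc 1 by apply: runs_instr.
  have fc : frame [:: rOff] sb sc by frame_tac.
  exists sc; split.
  + apply: (runs_le (runs_seq ra (runs_seq rb rc))); lia.
  + by rewrite fc // fb.
  + by rewrite fc.
  + by rewrite fc // uN.
  split.
  + have fd : frame [:: rI] sc (nset sc rI i.+1) by frame_tac.
    have fa : frame [::] s sa by [].
    by apply: (frame_sub (frame_trans e1 (frame_trans fa (frame_trans fb (frame_trans fc fd))))).
  + by rewrite /= /upd /= bOff uL mulSn addnC.
  + move=> j jZ; rewrite -[fmem (nset sc _ _)]/(fmem sb) [LHS]gb ?ga.
      by rewrite (_ : (_ == _) = false) ?e3 //; lia.
    by rewrite /= /in_row [nmem sa rOff]e2 dL; lia.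
  + move=> i' k iN'' kL; rewrite -[fmem (nset sc _ _)]/(fmem sb).
    have [->|ne] := eqVneq i' i.
      by rewrite ltnSn; have := rowb k; rewrite uL bOff; apply.
    have dis : (i' * Len + k < i * Len) || (i * Len + Len <= i' * Len + k).
      have [lt|gt] : i' < i \/ i < i' by lia.
        have : i'.+1 * Len <= i * Len by rewrite leq_mul2r lt orbT.
        by rewrite mulSn; lia.
      have : i.+1 * Len <= i' * Len by rewrite leq_mul2r gt orbT.
      by rewrite mulSn; lia.
    rewrite [LHS]gb ?ga.
      rewrite (_ : (_ == _) = false) ?e4 //; last by lia.
      by rewrite [in RHS]ltnS [in RHS]leq_eqVlt (negPf ne).
    have := rowN i' k iN'' kL.
    by rewrite /= /in_row [nmem sa rOff]e2 dL; lia.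
exists s; split.
- by apply: (runs_le hs); lia.
- exact: (consts_frame e1 isT C).
- by move=> i k iN kL; rewrite e4 // iN.
Qed.
End MainLoop.

(** * Setting up parameters and memory *)

Definition Square (z x : nat) : program := Seq (Instr (NMove 10 x)) (Mul z x 10 rC).

Definition Params : program :=
  Seq (Instr (NConst rOne 1)) (Seq (Mul rT rN 1 rC) (Seq (Mul rX rT 2 rC)
    (Seq (Instr (NAdd rX rX rOne)) (Seq (Square rT rX) (Seq (Square rQ rT)
      (Seq (Square rR rQ) (Square rB rR))))))).

Definition LevelStep : program :=
  If (NLt 10 rN)
    (Seq (Instr (NAdd 10 10 10)) (Seq (Mul rT rZ rB rC)
      (Seq (Instr (NMove rZ rT)) (Instr (NAdd rLev rLev rOne)))))
    Skip.

Definition Levels : program :=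
  Seq (block [:: NMove rZ rB; NMove 10 rOne; NMove rLev rOne]) (For 13 rN LevelStep).

Definition Layout : program :=
  Seq (Square rLen rZ) (Seq (Mul rBase rN rLen rC)
    (block [:: NAdd rTmp rBase rZ; NAdd rCur rTmp rOne; NAdd rPrev rCur rOne; NConst rOff 0])).

Definition CopyAlphas : program :=
  For 13 rZ (block [:: NAdd rT rBase 13; FMove rT 13]).

Definition ClearRows : program := For 13 rBase (Instr (FZero 13)).

Definition ShiftProgram : program :=
  Seq Params (Seq Levels (Seq Layout (Seq CopyAlphas (Seq ClearRows
    (Seq Rows (Instr (NMove 0 rLen))))))).

Section Setup.
Variable K : fieldType.
Implicit Types (st s : state K).

Lemma runs_nset x a v st : exec_instr x st = nset st a v ->
  exists s, [/\ runs (Instr x) st s 1, nmem s a = v, frame [:: a] st s & fmem s = fmem st].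
Proof.
move=> e; exists (nset st a v); split => //=; first by rewrite -e; apply: runs_instr.
  by rewrite /upd eqxx.
by move=> r; rewrite inE /= /upd => /negPf->.
Qed.

Lemma runs_square z x st :
  uniq [:: z; x; 10; rC; rOne] -> nmem st rOne = 1 ->
  exists s, [/\ runs (Square z x) st s (3 * nmem st x + 4),
    nmem s z = nmem st x ^ 2, frame [:: 10; z; rC] st s & fmem s = fmem st].
Proof.
move=> u h1; have [s [r v f g]] := @runs_nset (NMove 10 x) 10 (nmem st x) st erefl.
have x10 : x \notin [:: 10].
  by move: u; rewrite /= !inE !negb_or => /andP[_] /andP[/andP[]].
have [|s' [r' v' f' g']] := @runs_mul K z x 10 rC s u; first by rewrite f.
exists s'; split.
- by apply: (runs_le (runs_seq r r')); rewrite v; lia.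
- by rewrite v' v f // mulnn.
- exact: frame_trans f f'.
- by rewrite g'.
Qed.

Lemma runs_params st :
  let: (n, d, w) := (nmem st rN, nmem st 1, nmem st 2) in
  let: X := (n * d * w).+1 in
  exists s, [/\ runs Params st s (3 * (d + w + X + X ^ 2 + X ^ 4 + X ^ 8) + 24),
    [/\ nmem s rOne = 1, nmem s rN = n, nmem s rX = X & nmem s rB = X ^ 16] &
    fmem s = fmem st].
Proof.
set n := nmem st rN; set d := nmem st 1; set w := nmem st 2; set X := (n * d * w).+1.
have [s1 [r1 v1 f1 g1]] := @runs_nset (NConst rOne 1) rOne 1 st erefl.
have [||s2 [r2 v2 f2 g2]] := @runs_mul K rT rN 1 rC s1; rewrite ?v1 //.
have F2 := frame_trans f1 f2; rewrite !f1 // -/n -/d in r2 v2.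
have [||s3 [r3 v3 f3 g3]] := @runs_mul K rX rT 2 rC s2; rewrite ?f2 ?v1 //.
have F3 := frame_trans F2 f3; rewrite v2 F2 // -/w in r3 v3.
have [s4 [r4 v4 f4 g4]] := @runs_nset (NAdd rX rX rOne) rX (nmem s3 rX + nmem s3 rOne) s3 erefl.
have f14 := frame_trans (frame_trans f2 f3) f4.
have {}v4 : nmem s4 rX = X by rewrite v4 v3 (frame_trans f2 f3) // v1 addn1.
have [||s5 [r5 v5 f5 g5]] := @runs_square rT rX s4; rewrite ?f14 ?v1 //.
have f15 := frame_trans f14 f5; rewrite v4 in r5 v5.
have [||s6 [r6 v6 f6 g6]] := @runs_square rQ rT s5; rewrite ?f15 ?v1 //.
have f16 := frame_trans f15 f6; rewrite v5 -expnM in r6 v6.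
have [||s7 [r7 v7 f7 g7]] := @runs_square rR rQ s6; rewrite ?f16 ?v1 //.
have f17 := frame_trans f16 f7; rewrite v6 -expnM in r7 v7.
have [||s8 [r8 v8 f8 g8]] := @runs_square rB rR s7; rewrite ?f17 ?v1 //.
have f18 := frame_trans f17 f8; rewrite v7 -expnM in r8 v8.
exists s8; split.
- apply: (runs_le (runs_seq r1 (runs_seq r2 (runs_seq r3 (runs_seq r4 (runs_seq r5
    (runs_seq r6 (runs_seq r7 r8)))))))).
  rewrite -[2 * 2 * 2]/8 -[2 * 2]/4; move: (X ^ 8) (X ^ 4) (X ^ 2) => x8 x4 x2; lia.
- split; [by rewrite f18 | by rewrite f18 // f1 | | exact: v8].
  by rewrite (frame_trans f5 (frame_trans f6 (frame_trans f7 f8))).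
- by rewrite g8 g7 g6 g5 g4 g3 g2 g1.
Qed.

Lemma ltn_up_log n m : (2 ^ m < n) = (m < up_log 2 n).
Proof.
apply/idP/idP; rewrite !ltnNge; apply: contra => h; last exact: up_log_min.
by apply: leq_trans (up_logP n (ltnSn 1)) _; rewrite leq_exp2l.
Qed.

(** Register 10 doubles while it is below n. As the ceiling of log n is at most n, n rounds suffice
    and the remaining ones are idle, hence the minimum in [u]. *)
Lemma runs_levels st : nmem st rOne = 1 ->
  let: (n, B) := (nmem st rN, nmem st rB) in
  exists s, [/\ runs Levels st s (n * (3 * B + 10) + 5),
    nmem s rLev = digits n /\ nmem s rZ = B ^ digits n,
    frame [:: 8; 9; 10; 13; rZ; rLev] st s & fmem s = fmem st].
Proof.
move=> h1; set n := nmem st rN; set B := nmem st rB.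
pose u x := minn x (up_log 2 n).
pose L := [:: 8; 9; 10; 13; rZ; rLev].
pose I x s := [/\ nmem s 10 = 2 ^ u x, nmem s rLev = (u x).+1, nmem s rZ = B ^ (u x).+1,
  frame L st s & fmem s = fmem st].
pose s0 : state K := foldl (fun s x => exec_instr x s) st
  [:: NMove rZ rB; NMove 10 rOne; NMove rLev rOne].
have [||||s [hs [_ e2 e3 e4 e5]]] := @runs_for K 13 rN LevelStep n (3 * B + 8) I s0 => //.
- by split => //=; rewrite /u ?min0n ?expn1 /upd //=; frame_tac.
- move=> x s xN [e1 e2 e3 e4 e5] si.
  have d1 : nmem s rOne = 1 by rewrite e4.
  have dN : nmem s rN = n by rewrite e4.
  have [lt|ge] := ltnP (2 ^ u x) n; last first.
    have uS : u x.+1 = u x by move: ge; rewrite leqNgt ltn_up_log /u; lia.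
    exists s; split => //.
      apply: (runs_le (T := 1)); last by lia.
      by apply: runs_if_false (runs_skip _); rewrite /= e1 dN -leqNgt.
    split; rewrite ?uS //.
    by apply: (frame_sub (frame_trans e4 (_ : frame [:: 13] s _))) => //; frame_tac.
  have uS : u x.+1 = (u x).+1 by move: lt; rewrite ltn_up_log /u; lia.
  have [s1 [r1 v1 f1 g1]] := @runs_nset (NAdd 10 10 10) 10 (nmem s 10 + nmem s 10) s erefl.
  have [||s2 [r2 v2 f2 g2]] := @runs_mul K rT rZ rB rC s1; rewrite ?f1 //.
  rewrite !f1 // e3 e4 // -/B in r2 v2.
  have [s3 [r3 v3 f3 g3]] := @runs_nset (NMove rZ rT) rZ (nmem s2 rT) s2 erefl.
  have [s4 [r4 v4 f4 g4]] := @runs_nset (NAdd rLev rLev rOne) rLev (nmem s3 rLev + nmem s3 rOne) s3 erefl.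
  have F := frame_trans f1 (frame_trans f2 (frame_trans f3 f4)).
  exists s4; split.
  + apply: (runs_le (T := (1 + ((3 * B + 3) + (1 + 1))).+1)); last by lia.
    apply: runs_if_true; first by rewrite /= e1 dN.
    exact: (runs_seq r1 (runs_seq r2 (runs_seq r3 r4))).
  + by rewrite F.
  + by rewrite F.
  + by rewrite F.
  have f13 : frame [:: 13] s4 (nset s4 13 x.+1) by frame_tac.
  split; rewrite ?uS.
  + rewrite f13 // (frame_trans f2 (frame_trans f3 f4)) // v1 e1 expnS; lia.
  + by rewrite f13 // v4 (frame_trans f1 (frame_trans f2 f3)) // e2
      (frame_trans f1 (frame_trans f2 f3)) // d1 addn1.
  + by rewrite f13 // f4 // v3 v2 [in RHS]expnSr.
  + by apply: (frame_sub (frame_trans e4 (frame_trans F f13))).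
  + by rewrite /= g4 g3 g2 g1.
have un : u n = up_log 2 n.
  by apply/minn_idPr/up_log_min => //; apply/ltnW/ltn_expl.
exists s; split => //; last by rewrite /digits -un.
by apply: (runs_le (runs_seq (runs_block _ _) hs)); rewrite /=; lia.
Qed.

Lemma runs_layout st n X B lev Z :
  nmem st rOne = 1 -> nmem st rN = n -> nmem st rX = X -> nmem st rB = B ->
  nmem st rLev = lev -> nmem st rZ = Z ->
  exists s, [/\ runs Layout st s (3 * Z + 3 * Z ^ 2 + 11), consts n X B lev Z (Z ^ 2) s,
    nmem s rOff = 0 & fmem s = fmem st].
Proof.
move=> h1 hN hX hB hl hZ.
have [||s1 [r1 v1 f1 g1]] := @runs_square rLen rZ st => //.
rewrite hZ in r1 v1.
have [||s2 [r2 v2 f2 g2]] := @runs_mul K rBase rN rLen rC s1; rewrite ?f1 //.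
rewrite v1 f1 // hN in r2 v2.
pose s3 : state K := foldl (fun s x => exec_instr x s) s2
  [:: NAdd rTmp rBase rZ; NAdd rCur rTmp rOne; NAdd rPrev rCur rOne; NConst rOff 0].
have f12 := frame_trans f1 f2.
exists s3; split => //; last by rewrite /= g2.
  by apply: (runs_le (runs_seq r1 (runs_seq r2 (runs_block _ _)))); rewrite /=; lia.
rewrite /consts /= /upd /= v2 (f2 rLen) // v1 !f12 // h1 hN hX hB hl hZ.
by rewrite -!addnA.
Qed.

(** The target begins at n * Len >= Z, beyond the source cells, so copying never overwrites an alpha
    still to be read. *)
Lemma runs_copy st n X B lev Z Len (alpha : nat -> K) :
  consts n X B lev Z Len st -> 0 < n -> Z <= Len ->
  (forall j, j < Z -> fmem st j = alpha j) ->
  exists s, [/\ runs CopyAlphas st s (4 * Z + 2), frame [:: rT; 13] st s &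
    alphas_at n Z Len alpha s].
Proof.
move=> C n0 ZL hal; have [c1 cN cX cB cl cZ cL cb ct cc cp] := C.
have ZnL : Z <= n * Len by apply: leq_trans ZL (leq_pmull _ n0).
pose I k s := [/\ frame [:: rT; 13] st s, forall j, j < Z -> fmem s j = alpha j &
  forall j, j < k -> fmem s (n * Len + j) = alpha j].
have [||||s [hs [e1 e2 e3]]] := @runs_for K 13 rZ (block [:: NAdd rT rBase 13; FMove rT 13]) Z 2 I st => //.
- by split => //; frame_tac.
- move=> k s kZ [e1 e2 e3] si.
  pose s' : state K := foldl (fun s x => exec_instr x s) s [:: NAdd rT rBase 13; FMove rT 13].
  have m' : nmem s' = upd (nmem s) rT (n * Len + k) by rewrite /= si e1 // cb.
  have f' a : fmem s' a = if a == n * Len + k then alpha k else fmem s a.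
    by rewrite /= /fget /= /upd /= si e1 // cb e2.
  exists s'; split; first exact: runs_block.
  + by rewrite m'.
  + by rewrite m' /upd /= e1.
  + by rewrite m' /upd /= e1.
  split.
  + by rewrite /frame -[nmem (nset s' _ _)]/(upd (nmem s') 13 k.+1) m'; frame_from e1.
  + move=> j jZ; rewrite -[fmem (nset s' _ _)]/(fmem s') f' (_ : (_ == _) = false) ?e2 //.
    by lia.
  + move=> j; rewrite -[fmem (nset s' _ _)]/(fmem s') f' eqn_add2l ltnS leq_eqVlt.
    by case: eqP => [->|] //= _; apply: e3.
by exists s; split => //; apply: (runs_le hs); lia.
Qed.

Lemma runs_clear st n X B lev Z Len (alpha : nat -> K) :
  consts n X B lev Z Len st -> alphas_at n Z Len alpha st ->
  exists s, [/\ runs ClearRows st s (3 * (n * Len) + 2), frame [:: 13] st s,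
    alphas_at n Z Len alpha s & forall a, a < n * Len -> fmem s a = 0%R].
Proof.
move=> C hal; have [c1 cN cX cB cl cZ cL cb ct cc cp] := C.
pose I k s := [/\ frame [:: 13] st s, alphas_at n Z Len alpha s &
  forall a, a < k -> fmem s a = 0%R].
have [||||s [hs [e1 e2 e3]]] := @runs_for K 13 rBase (Instr (FZero 13)) (n * Len) 1 I st => //.
- by split => //; frame_tac.
- move=> k s kN [e1 e2 e3] si.
  pose s' : state K := fset s 13 0%R.
  have f' a : fmem s' a = if a == k then 0%R else fmem s a by rewrite /= /upd si.
  exists s'; split; first exact: runs_instr.
  + exact: si.
  + by rewrite /= e1.
  + by rewrite /= e1.
  split.
  + by frame_from e1.
  + by move=> j jZ; rewrite -[fmem (nset s' _ _)]/(fmem s') f' (_ : (_ == _) = false) ?e2 //; lia.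
  + move=> a; rewrite -[fmem (nset s' _ _)]/(fmem s') f' ltnS leq_eqVlt.
    by case: eqP => //= _; apply: e3.
by exists s; split => //; apply: (runs_le hs); lia.
Qed.
End Setup.

(** * Running time, degree and conclusion *)

(** Every parameter is at most Z, so the time is at most a constant times Z^5; the constant is
    absorbed by Z >= 512. *)
Lemma program_time_le (n d w X B lev Z : nat) :
  0 < n -> n <= Z -> d <= Z -> w <= Z -> X <= Z -> X ^ 2 <= Z -> X ^ 4 <= Z -> X ^ 8 <= Z ->
  B <= Z -> lev <= Z -> 512 <= Z ->
  (3 * (d + w + X + X ^ 2 + X ^ 4 + X ^ 8) + 24) +
  ((n * (3 * B + 10) + 5) + ((3 * Z + 3 * Z ^ 2 + 11) + ((4 * Z + 2) +
  ((3 * (n * Z ^ 2) + 2) + ((n * (Z * (row_time n X B lev Z (Z ^ 2) + 2) + 6) + 2) + 1))))) +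
  n * Z ^ 2 <= Z ^ 6.
Proof.
move=> n0 nZ dZ wZ XZ; move: (X ^ 2) (X ^ 4) (X ^ 8) => X2 X4 X8 X2Z X4Z X8Z BZ lZ bZ.
have Zp m : Z ^ m <= Z ^ m.+1 by rewrite leq_exp2l; lia.
have p2 := Zp 1; have p3 := Zp 2; have p4 := Zp 3; have p5 := Zp 4.
have Zm m a b : a <= Z -> b <= Z ^ m -> a * b <= Z ^ m.+1.
  by move=> h1 h2; rewrite expnS leq_mul.
rewrite expn1 in p2.
have t1 : n * (5 * X + 6) <= 11 * Z ^ 2.
  by rewrite -mulnn mulnA (mulnC 11) -mulnA leq_mul //; lia.
have t2 : lev * (6 * Z + n * (5 * X + 6) + 6 * B + 21) <= 44 * Z ^ 3.
  apply: (@leq_trans (Z * (44 * Z ^ 2))); last by rewrite mulnCA -expnS.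
  by rewrite leq_mul //; lia.
have t3 : Z * (7 * Z ^ 2 + 5) <= 12 * Z ^ 3.
  apply: (@leq_trans (Z * (12 * Z ^ 2))); last by rewrite mulnCA -expnS.
  by rewrite leq_mul2l; apply/orP; right; lia.
have t4 : row_time n X B lev Z (Z ^ 2) <= 64 * Z ^ 3 by rewrite /row_time; lia.
have t5 : Z * (row_time n X B lev Z (Z ^ 2) + 2) <= 66 * Z ^ 4.
  apply: (@leq_trans (Z * (66 * Z ^ 3))); last by rewrite mulnCA -expnS.
  by rewrite leq_mul2l; apply/orP; right; lia.
have t6 : n * (Z * (row_time n X B lev Z (Z ^ 2) + 2) + 6) <= 72 * Z ^ 5.
  apply: (@leq_trans (Z * (72 * Z ^ 4))); last by rewrite mulnCA -expnS.
  by rewrite leq_mul //; lia.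
have t7 : n * (3 * B + 10) <= 13 * Z ^ 2.
  by rewrite -mulnn mulnA (mulnC 13) -mulnA leq_mul //; lia.
have t8 : n * Z ^ 2 <= Z ^ 3 by apply: Zm.
have t9 : 512 * Z ^ 5 <= Z ^ 6 by rewrite (expnS Z 5) leq_mul.
move: (Z ^ 2) (Z ^ 3) (Z ^ 4) (Z ^ 5) (Z ^ 6) (row_time _ _ _ _ _ _)
  p2 p3 p4 p5 t1 t2 t3 t4 t5 t6 t7 t8 t9 => *; lia.
Qed.

Lemma runs_shift_program (K : fieldType) (n d w : nat) (alpha : seq K) :
  0 < n -> 0 < d -> 0 < w ->
  let Z := num_weights n d w in
  exists st (T : nat), [/\ runs ShiftProgram (initial_state n d w alpha) st T,
    T + n * Z ^ 2 <= Z ^ 6, nmem st 0 = Z ^ 2 &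
    forall i k, i < n -> k < Z ^ 2 ->
      fmem st (i * Z ^ 2 + k) = ((shift_poly n d w alpha i)`_k)%R].
Proof.
move=> n0 d0 w0 Z; set X := base_size n d w; set B := radix n d w; set lev := digits n.
have [s1 [r1 [h1 hN hX hB] g1]] := runs_params (initial_state n d w alpha).
rewrite [nmem _ rN]/= [nmem _ 1]/= [nmem _ 2]/= -/(base_size n d w) -/X in r1 hN hX hB.
have [s2 [r2 [hl hZ] f2 g2]] := runs_levels h1.
rewrite hN hB -/(radix n d w) -/B -/lev -/Z in r2 hl hZ.
have B0 : 0 < B by rewrite /B /radix expn_gt0.
have B1 : 2 ^ 16 <= B by rewrite /B /radix leq_exp2r // /base_size ltnS !muln_gt0 n0 d0.
have BZ : B <= Z by rewrite -[B]expn1 /Z /num_weights -/B leq_exp2l //; apply: leq_trans B1.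
have levZ : lev <= Z.
  apply: (@leq_trans (2 ^ lev)); first by apply/ltnW/ltn_expl.
  by rewrite leq_exp2r //; apply: leq_trans B1.
have Xm m : m <= 16 -> X ^ m <= Z.
  by move=> hm; apply: leq_trans BZ; rewrite leq_pexp2l.
have XZ : X <= Z by rewrite -[X]expn1 Xm.
have nd0 : 0 < n * d by rewrite muln_gt0 n0.
have nX : n <= X by apply: leqW; apply: leq_trans (leq_pmulr _ w0); apply: leq_pmulr.
have dX : d <= X by apply: leqW; apply: leq_trans (leq_pmulr _ w0); apply: leq_pmull.
have wX : w <= X by apply: leqW; apply: leq_pmull.
have Z0 : 0 < Z by apply: leq_trans BZ.
have [s3 [r3 C3 o3 g3]] := runs_layout (etrans (f2 rOne isT) h1) (etrans (f2 rN isT) hN)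
  (etrans (f2 rX isT) hX) (etrans (f2 rB isT) hB) hl hZ.
have [|j jZ|s4 [r4 f4 a4]] := runs_copy (alpha := nth 0%R alpha) C3 n0.
- by rewrite -mulnn leq_pmulr.
- by rewrite g3 g2 g1.
have C4 := consts_frame f4 isT C3.
have [s5 [r5 f5 a5 z5]] := runs_clear C4 a4.
have C5 := consts_frame f5 isT C4.
have [||s6 [r6 C6 rows6]] := runs_rows B0 (erefl : Z = B ^ lev) _ C5 a5 _ z5.
- by rewrite expn_gt0 Z0.
- by rewrite f5 // f4.
have [s7 [r7 v7 f7 g7]] := @runs_nset K (NMove 0 rLen) 0 (nmem s6 rLen) s6 erefl.
exists s7; eexists; split.
- exact: (runs_seq r1 (runs_seq r2 (runs_seq r3 (runs_seq r4 (runs_seq r5 (runs_seq r6 r7)))))).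
- have bZ : 512 <= Z by apply: leq_trans BZ; apply: leq_trans B1.
  apply: program_time_le; rewrite ?Xm //.
  + exact: leq_trans nX XZ.
  + exact: leq_trans dX XZ.
  + exact: leq_trans wX XZ.
- by rewrite v7; case: C6.
- by move=> i k iN kL; rewrite g7 rows6.
Qed.

Lemma size_prod_linear (R : idomainType) (m : nat) (a : nat -> R) (e : nat -> nat) :
  size (\prod_(l < m) ('X - (a l)%:P) ^+ e l)%R = (\sum_(l < m) e l).+1.
Proof.
have mon k : (\prod_(l < k) ('X - (a l)%:P) ^+ e l)%R \is monic.
  by apply: monic_prod => l _; apply/monic_exp/monicXsubC.
elim: m => [|m IH]; first by rewrite !big_ord0 size_poly1.
rewrite !big_ord_recr /= size_Mmonic ?monic_exp ?monicXsubC ?(monic_neq0 (mon m)) //.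
by rewrite IH size_exp_XsubC addSn addnS.
Qed.

(** There are Z factors with exponents at most Z - 1, so the degree is below Z^2, the row length
    used by the program; hence no coefficient is truncated. *)
Lemma size_shift_poly (F : fieldType) (n d w : nat) (alpha : seq F) (i : nat) :
  size (shift_poly n d w alpha i) <= num_weights n d w ^ 2.
Proof.
have Z0 : 0 < num_weights n d w by rewrite !expn_gt0.
rewrite (size_prod_linear _ (fun l => nth 0%R alpha l) (fun l => weight n d w l i)).
apply: (@leq_ltn_trans (\sum_(l < num_weights n d w) (num_weights n d w).-1)).
  apply: leq_sum => l _; rewrite -ltnS prednK //.
  by apply: digit_weight_lt; rewrite expn_gt0.
by rewrite sum_nat_const card_ord -mulnn ltn_pmul2l // prednK.
Qed.

(** The constant collects n * d * w + 1 <= Y^2, the radix exponent 16, at most 3 * t digits, and the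
    sixth power from the running time. *)
Lemma num_weights_le (n d w : nat) :
  0 < n -> 0 < d -> 0 < w ->
  num_weights n d w ^ 6 <= qpoly_bound (2 * 16 * 3 * 6) n d w.
Proof.
move=> n0 d0 w0; rewrite /qpoly_bound /num_weights /radix /base_size.
set Y := maxn 2 (n * d * w); set t := trunc_log 2 _.
have Y2 : 2 <= Y by rewrite leq_maxl.
have XY : (n * d * w).+1 <= Y ^ 2.
  have h : n * d * w <= Y by rewrite leq_maxr.
  by apply: leq_trans (_ : Y * 2 <= _); [lia | rewrite leq_mul2l Y2 orbT].
have t1 : 1 <= t by apply: trunc_log_max; rewrite ?leq_maxl.
have dt : digits n <= 3 * t.
  apply: (@leq_trans t.+2); last by lia.
  rewrite /digits ltnS up_log_min //; apply: (@leq_trans (maxn 2 n)); first exact: leq_maxr.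
  by apply/ltnW/trunc_log_ltn.
have ct : 2 * (16 * (digits n * 6)) <= 2 * 16 * 3 * 6 * t by lia.
have e0 : 0 < 16 * (digits n * 6) by rewrite /digits; lia.
rewrite -expnM -expnM; move: (16 * (digits n * 6)) (2 * 16 * 3 * 6 * t) ct e0 => e e' ct e0.
apply: (@leq_trans ((Y ^ 2) ^ e)); first by rewrite leq_exp2r.
by rewrite -expnM leq_exp2l.
Qed.

Local Open Scope ring_scope.

Theorem theorem5p6 :
  exists (P : program) (c : nat),
  forall (F : fieldType) (n d w : nat) (alpha : seq F),
    (0 < n)%N -> (0 < d)%N -> (0 < w)%N ->
    (* F is sufficiently large *)
    uniq alpha -> (qpoly_bound c n d w <= size alpha)%N ->
  exists f : n.-tuple {poly F},
    [/\ computes_within P d w alpha f (qpoly_bound c n d w),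
        forall i : 'I_n, ((size (tnth f i)).-1 <= qpoly_bound c n d w)%N
      & [/\ forall A : 'M[{mpoly F[n]}]_(w, w),
              individual_degree_le d A -> computed_by_roabp w A ->
              concentrated (roabp_threshold w) (shift f A),
            forall A : 'M[{mpoly F[n]}]_(1, w),
              individual_degree_le d A -> computed_by_roabp w A ->
              concentrated (roabp_threshold w) (shift f A)
          & forall A : {mpoly F[n]},
              individual_degree_le d (A%:M : 'M_(1, 1)) ->
              computed_by_roabp w (A%:M : 'M_(1, 1)) ->
              concentrated (roabp_threshold w) (shift f (A%:M : 'M_(1, 1)))]].
Proof.
exists ShiftProgram, (2 * 16 * 3 * 6)%N => F n d w alpha n0 d0 w0 ualpha.
have := num_weights_le n0 d0 w0; move: (qpoly_bound _ _ _ _) => T Z6 salpha.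
(* One bound serves three times: Z alphas are available, the degree is below Z^2, and the time is at
   most Z^6. *)
have Zpow m : (m <= 6 -> num_weights n d w ^ m <= T)%N.
  by move=> m6; apply: leq_trans Z6; rewrite leq_pexp2l // !expn_gt0.
have sZ : (num_weights n d w <= size alpha)%N.
  by apply: leq_trans salpha; rewrite -[num_weights _ _ _]expn1 Zpow.
exists [tuple shift_poly n d w alpha i | i < n]; split.
- have [st [T' [[t ht tT] T'le L0 hrow]]] := runs_shift_program alpha n0 d0 w0.
  exists st, t; split => //.
    apply: eq_from_tnth => i; rewrite !tnth_mktuple L0; apply/polyP => k.
    rewrite coef_poly; case: ltnP => [kL|Lk]; first by rewrite hrow.
    by rewrite nth_default // (leq_trans (size_shift_poly n d w alpha i)).
  by rewrite L0; apply: leq_trans Z6; apply: leq_trans T'le; rewrite leq_add2r.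
- move=> i; rewrite tnth_mktuple; apply: leq_trans (leq_pred _) _.
  by apply: leq_trans (size_shift_poly n d w alpha i) (Zpow 2 _).
- by split=> A hA rA; apply: concentrated_shift_poly hA rA.
Qed.
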